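(* Let $K$ be an irreducible Markov kernel on $\mathcal{X}=\{1,\dots,n\}$ with stationary distribution $\pi$, Dirichlet form $\mathcal{E}$ and log-Sobolev constant $\alpha$. Let $\epsilon\in(0,1)$ and let $P\in\mathbb{R}[x_1,\dots,x_n]$ be a polynomial such that $\mathrm{Ent}_\pi[x^2]\le P(x)\le(1+\epsilon)\mathrm{Ent}_\pi[x^2]$ for all $x\in S^\pi$. For $d\ge\frac12\deg P$ let $\gamma_d^*=\inf\{\gamma\in\mathbb{R}:\gamma\,\mathcal{E}(x,x)-P(x)\in\mathsf{SOS}_d(S^\pi)\}$ (with $\gamma_d^*=+\infty$ if the set is empty) and $\alpha_d^P=1/\gamma_d^*$ (with $1/(+\infty)=0$). Then $\alpha_d^P\le\alpha$ for all such $d$, and there exists $d_0\in\mathbb{N}$ such that $\alpha_d^P\ge(1-\epsilon)\alpha$ for every $d\ge d_0$.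
   Context: A Markov kernel $K$ on $\mathcal{X}$ is a matrix with $K_{ij}\ge0$, $\sum_j K_{ij}=1$; irreducibility gives a unique stationary distribution $\pi$ with all $\pi_i>0$. Dirichlet form: $\mathcal{E}(x,x)=\frac12\sum_{i,j}\pi_iK_{ij}(x_i-x_j)^2$. Write $\|x\|_\pi^2=\sum_i\pi_ix_i^2$ and $\mathrm{Ent}_\pi[x^2]=\sum_i\pi_ix_i^2\log(x_i^2/\|x\|_\pi^2)$. The log-Sobolev constant $\alpha$ is the largest constant with $\mathcal{E}(x,x)\ge\alpha\,\mathrm{Ent}_\pi[x^2]$ for all $x\in\mathbb{R}^n$. $S^\pi=\{x\in\mathbb{R}^n_{\ge0}:\|x\|_\pi^2=1\}$. $\Sigma[x]_{2k}$ denotes sums of squares of polynomials of degree $\le k$. Define $\mathsf{SOS}_d(S^\pi)=\{f\in\mathbb{R}[x]_{2d}: f=\sigma_0+\sum_{i=1}^n x_i\sigma_i+\phi\,(\|x\|_\pi^2-1),\ \sigma_0\in\Sigma[x]_{2d},\ \sigma_i\in\Sigma[x]_{2d-2},\ \phi\in\mathbb{R}[x]_{2d-2}\}$. *)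

(* Defs.v *)
From HB Require Import structures.
From mathcomp Require Import all_boot all_order all_algebra.
From mathcomp Require Import mpoly.
(* mpoly must be imported BEFORE the mathcomp-analysis files (notation levels). *)
From mathcomp Require Import classical_sets reals constructive_ereal ereal exp.

Set Implicit Arguments.
Unset Strict Implicit.
Unset Printing Implicit Defensive.

Import Order.TTheory GRing.Theory Num.Theory.
Local Open Scope ring_scope.

Section MarkovLSI.
Context {R : realType} {n : nat}.

(** Markov kernel on X = 'I_n (states 1..n are 0..n-1 here). *)
Definition markov_kernel (K : 'M[R]_n) : Prop :=
  (forall i j, 0 <= K i j) /\ (forall i, \sum_j K i j = 1).

(** k-th matrix power (iterated product; 'M_n is only a ring for n > 0). *)
Definition mxpow (K : 'M[R]_n) (k : nat) : 'M[R]_n := iter k (fun M => M *m K) 1%:M.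

Definition irreducible (K : 'M[R]_n) : Prop :=
  forall i j, exists k, 0 < mxpow K k i j.

Definition stationary_distribution (K : 'M[R]_n) (pi : 'I_n -> R) : Prop :=
  (forall i, 0 <= pi i) /\ \sum_i pi i = 1 /\
  (forall j, \sum_i pi i * K i j = pi j).

Definition dirichlet (K : 'M[R]_n) (pi : 'I_n -> R) (x : 'I_n -> R) : R :=
  2^-1 * \sum_i \sum_j pi i * K i j * (x i - x j) ^+ 2.

Definition normpi2 (pi : 'I_n -> R) (x : 'I_n -> R) : R :=
  \sum_i pi i * x i ^+ 2.

(** Ent_pi[x^2] (ln 0 = 0 in mathcomp-analysis, giving the usual 0 log 0 = 0). *)
Definition ent (pi : 'I_n -> R) (x : 'I_n -> R) : R :=
  \sum_i pi i * x i ^+ 2 * ln (x i ^+ 2 / normpi2 pi x).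

Definition is_log_sobolev_constant (K : 'M[R]_n) (pi : 'I_n -> R) (alpha : R) : Prop :=
  (forall x, alpha * ent pi x <= dirichlet K pi x) /\
  (forall a, (forall x, a * ent pi x <= dirichlet K pi x) -> a <= alpha).

Definition Spi (pi : 'I_n -> R) (x : 'I_n -> R) : Prop :=
  (forall i, 0 <= x i) /\ normpi2 pi x = 1.

Definition mpol := {mpoly R[n]}.
Definition X (i : 'I_n) : mpol := 'X_i.
Definition cst (c : R) : mpol := c%:MP_[n].
Definition peval (x : 'I_n -> R) (p : mpol) : R := p.@[x].

(** deg_lt p m  <->  msize p <= m  <->  deg p <= m - 1  (m = 0 forces p = 0). *)
Definition deg_lt (p : mpol) (m : nat) : bool :=
  (msize p <= m)%N.

(** SOS of squares of polynomials q with deg_lt q m, i.e. Sigma[x]_{2(m-1)}. *)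
Definition sos_sq (m : nat) (s : mpol) : Prop :=
  exists qs : seq mpol, all (fun q => deg_lt q m) qs /\ s = \sum_(q <- qs) q ^+ 2.

Definition normpi2_poly (pi : 'I_n -> R) : mpol := \sum_i cst (pi i) * X i ^+ 2.

(** SOS_d(S^pi): f in R[x]_{2d}, f = s0 + sum_i x_i s_i + phi (||x||_pi^2 - 1),
    s0 in Sigma_{2d}, s_i in Sigma_{2d-2}, phi in R[x]_{2d-2}. *)
Definition SOS_Spi (pi : 'I_n -> R) (d : nat) (f : mpol) : Prop :=
  deg_lt f (2 * d).+1 /\
  exists (s0 : mpol) (s : 'I_n -> mpol) (phi : mpol),
    sos_sq d.+1 s0 /\ (forall i, sos_sq d (s i)) /\ deg_lt phi (2 * d - 1) /\
    f = s0 + \sum_i X i * s i + phi * (normpi2_poly pi - 1).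

Definition dirichlet_poly (K : 'M[R]_n) (pi : 'I_n -> R) : mpol :=
  cst 2^-1 * \sum_i \sum_j cst (pi i * K i j) * (X i - X j) ^+ 2.

(** gamma_d^* (extended real; inf of the empty set is +oo). *)
Definition gamma_star (K : 'M[R]_n) (pi : 'I_n -> R) (P : mpol) (d : nat) : \bar R :=
  ereal_inf [set (g%:E)%E | g in
             [set g : R | SOS_Spi pi d (cst g * dirichlet_poly K pi - P)]].

Definition alpha_P (K : 'M[R]_n) (pi : 'I_n -> R) (P : mpol) (d : nat) : R :=
  match gamma_star K pi P d with
  | EFin g => g^-1
  | _ => 0
  end.

End MarkovLSI.

(* Main.v *)
(* Write y = x - 1 and let kappa = eps^2 / (1 - eps).  For
   gamma = 1 / ((1 - eps) alpha), the polynomial f = gamma E - P satisfies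
   f >= kappa Ent >= kappa |y|_pi^2 on S^pi and vanishes at the all-ones point,
   so it suffices to certify such an f exactly.

   Positive polynomials (Putinar).  Modulo |x|_pi^2 = 1 the sums of squares form
   an Archimedean preorder containing c + x_i and c - x_i, hence the Bernstein
   partition of unity on the box [-c, c]^n.  A Lipschitz estimate certified in
   that preorder bounds g below near each grid node: on nodes close to S^pi by
   the minimum of g, on the others after subtracting D x_i or adding
   D (|x|_pi^2 - 1)^2.

   The zero.  Comparing f with kappa |y|_pi^2 along curves of the sphere through
   the all-ones point shows that the linear part of f is a multiple of the
   normal, which is quadratic in y on the sphere, and that the Hessian is
   positive definite on the tangent space.  A Cholesky decomposition gives
   f = s + sum_i y_i^2 g_i with s a sum of squares and g_i > 0 near the zero.
   With w = 1 - |y|^2 / Q, the same identity holds for w^m s and the weights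
   g_i w^m + f (1 - w^m) / |y|^2, which for large m are positive on all of S^pi. *)
Require Import Defs.
From HB Require Import structures.
From mathcomp Require Import all_boot all_order all_algebra.
From mathcomp Require Import mpoly.
From mathcomp Require Import boolp classical_sets reals constructive_ereal ereal exp.
From mathcomp Require Import topology normedtype.
From mathcomp Require Import ring lra zify.
Import Order.TTheory GRing.Theory Num.Theory.
Import numFieldNormedType.Exports.
Local Open Scope ring_scope.

Set Implicit Arguments.
Unset Strict Implicit.
Unset Printing Implicit Defensive.

(** * Sums of squares modulo the sphere *)

Section Sos.
Context {R : realType} {n : nat}.
Implicit Types (p q s f g : {mpoly R[n]}) (c : R).

(** Spares monomial bookkeeping: [lip_ex], [curve_cvg] and [taylor_one] concern properties stable
    under sums and products. *)
Lemma mpoly_alg_ind (Q : {mpoly R[n]} -> Prop) :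
  (forall c, Q c%:MP_[n]) -> (forall i, Q 'X_i) ->
  (forall p q, Q p -> Q q -> Q (p + q)) ->
  (forall p q, Q p -> Q q -> Q (p * q)) ->
  forall p, Q p.
Proof.
move=> QC QX QD QM; elim/mpolyind => [|c m p _ _ Qp].
  by rewrite -mpolyC0.
apply: (QD _ _ _ Qp); rewrite -mul_mpolyC mpolyXE_id.
apply: (QM) => //; apply: (big_ind Q) => //.
  by rewrite -mpolyC1.
move=> i _; elim: (m i) => [|k IHk]; first by rewrite expr0 -mpolyC1.
by rewrite exprS; apply: QM.
Qed.

(** Degree bounds are dropped here and restored only in [Spi_module_SOS_Spi], by taking d large. *)
Definition sos s := exists m, sos_sq m s.

Lemma sosP s : sos s <-> exists qs : seq {mpoly R[n]}, s = \sum_(q <- qs) q ^+ 2.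
Proof.
split=> [[m [qs [_ ->]]]|[qs ->]]; first by exists qs.
exists (\max_(q <- qs) msize q)%N, qs; split=> //.
by apply/allP => q qs_q; rewrite /deg_lt; apply: leq_bigmax_seq.
Qed.

Lemma sos_sqr p : sos (p ^+ 2).
Proof. by apply/sosP; exists [:: p]; rewrite big_seq1. Qed.

Lemma sos0 : sos 0.
Proof. by apply/sosP; exists [::]; rewrite big_nil. Qed.

Lemma sosD p q : sos p -> sos q -> sos (p + q).
Proof.
move=> /sosP[ps ->] /sosP[qs ->]; apply/sosP.
by exists (ps ++ qs); rewrite big_cat.
Qed.

Lemma sos_sum (I : Type) (r : seq I) (Q : pred I) (F : I -> {mpoly R[n]}) :
  (forall i, Q i -> sos (F i)) -> sos (\sum_(i <- r | Q i) F i).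
Proof. move=> sF; apply: big_ind => //; [exact: sos0|exact: sosD]. Qed.

Lemma sosM p q : sos p -> sos q -> sos (p * q).
Proof.
move=> /sosP[ps ->] /sosP[qs ->].
rewrite mulr_suml; apply: sos_sum => p' _.
rewrite mulr_sumr; apply: sos_sum => q' _.
by rewrite -exprMn; apply: sos_sqr.
Qed.

Lemma sosC c : 0 <= c -> sos c%:MP_[n].
Proof.
by move=> c0; rewrite -(sqr_sqrtr c0) rmorphXn; apply: sos_sqr.
Qed.

Lemma sos_eval (x : 'I_n -> R) s : sos s -> 0 <= s.@[x].
Proof.
move=> /sosP[qs ->]; rewrite raddf_sum sumr_ge0 // => q _.
by rewrite /= rmorphXn sqr_ge0.
Qed.

Context (pi : 'I_n -> R).
Local Notation nn := (normpi2_poly pi : {mpoly R[n]}).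

Lemma Spi_normalize x : 0 < normpi2 pi x ->
  Spi pi (fun i => `|x i| / Num.sqrt (normpi2 pi x)).
Proof.
move=> x0; split=> [i|]; first by rewrite divr_ge0 ?sqrtr_ge0.
rewrite {1}/normpi2 (eq_bigr (fun i => pi i * x i ^+ 2 * (normpi2 pi x)^-1)).
  by rewrite -mulr_suml; apply/mulfV/lt0r_neq0.
by move=> i _; rewrite expr_div_n sqr_sqrtr ?ltW // real_normK ?num_real // mulrA.
Qed.

(** * Congruence modulo the sphere and the two cones of certificates *)

Definition eq_sphere f g := exists phi : {mpoly R[n]}, f = g + phi * (nn - 1).

Lemma eq_sphere_refl f : eq_sphere f f.
Proof. by exists 0; ring. Qed.

Lemma eq_sphere_trans g f h : eq_sphere f g -> eq_sphere g h -> eq_sphere f h.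
Proof. by move=> [phi ->] [psi ->]; exists (phi + psi); ring. Qed.

Lemma eq_sphereD f f' g g' :
  eq_sphere f f' -> eq_sphere g g' -> eq_sphere (f + g) (f' + g').
Proof. by move=> [phi ->] [psi ->]; exists (phi + psi); ring. Qed.

Lemma eq_sphereMl h f g : eq_sphere f g -> eq_sphere (h * f) (h * g).
Proof. by move=> [phi ->]; exists (h * phi); ring. Qed.

Lemma normpi2_poly_eval x : nn.@[x] = normpi2 pi x.
Proof.
rewrite /normpi2_poly raddf_sum; apply: eq_bigr => i _.
by rewrite /= mevalM rmorphXn /= mevalC mevalXU.
Qed.

Lemma eq_sphere_eval x f g :
  normpi2 pi x = 1 -> eq_sphere f g -> f.@[x] = g.@[x].
Proof.
move=> x1 [phi ->].
by rewrite mevalD mevalM mevalB normpi2_poly_eval x1 meval1 subrr mulr0 addr0.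
Qed.

Definition sphere_sos f := exists2 s, sos s & eq_sphere f s.

Lemma sphere_sosW s : sos s -> sphere_sos s.
Proof. by move=> ss; exists s => //; apply: eq_sphere_refl. Qed.

Lemma sphere_sosD f g : sphere_sos f -> sphere_sos g -> sphere_sos (f + g).
Proof.
move=> [s ss fs] [t st gt]; exists (s + t); first exact: sosD.
exact: eq_sphereD.
Qed.

Lemma sphere_sosM f g : sphere_sos f -> sphere_sos g -> sphere_sos (f * g).
Proof.
move=> [s ss fs] [t st gt]; exists (s * t); first exact: sosM.
apply: (eq_sphere_trans (g := f * t)); first exact: eq_sphereMl.
by rewrite ![_ * t]mulrC; apply: eq_sphereMl.
Qed.

Lemma sphere_sosC c : 0 <= c -> sphere_sos c%:MP_[n].
Proof. by move=> c0; apply/sphere_sosW/sosC. Qed.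

Lemma sphere_sos_sqr f : sphere_sos (f ^+ 2).
Proof. exact/sphere_sosW/sos_sqr. Qed.

Lemma sphere_sos_sum (I : Type) (r : seq I) (Q : pred I) (F : I -> {mpoly R[n]}) :
  (forall i, Q i -> sphere_sos (F i)) -> sphere_sos (\sum_(i <- r | Q i) F i).
Proof.
move=> sF; apply: big_ind => //; last exact: sphere_sosD.
exact/sphere_sosW/sos0.
Qed.

Lemma sphere_sosX f k : sphere_sos f -> sphere_sos (f ^+ k).
Proof.
move=> sf; elim: k => [|k IHk]; last by rewrite exprS; apply: sphere_sosM.
by rewrite expr0 -mpolyC1; apply: sphere_sosC.
Qed.

Lemma sphere_sos_eval x f : normpi2 pi x = 1 -> sphere_sos f -> 0 <= f.@[x].
Proof. by move=> x1 [s ss /(eq_sphere_eval x1)->]; apply: sos_eval. Qed.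

(** The union of the sets [SOS_Spi pi d] over all d. It is a quadratic module: products of the
    ['X_i] are not among its generators, so only multiplication by [sphere_sos] is available. *)
Definition Spi_module f := exists s0 (s : 'I_n -> {mpoly R[n]}),
  [/\ sos s0, forall i, sos (s i) & eq_sphere f (s0 + \sum_i 'X_i * s i)].

Lemma Spi_module_eq f g : eq_sphere f g -> Spi_module g -> Spi_module f.
Proof.
move=> fg [s0 [s [ss0 ss gs]]]; exists s0, s; split=> //.
exact: eq_sphere_trans gs.
Qed.

Lemma Spi_moduleW f : sphere_sos f -> Spi_module f.
Proof.
move=> [s ss fs]; exists s, (fun=> 0); split=> // [i|]; first exact: sos0.
by rewrite big1 ?addr0 // => i _; rewrite mulr0.
Qed.

Lemma Spi_moduleX i : Spi_module 'X_i.
Proof.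
exists 0, (fun j => ((i == j)%:R : R)%:MP_[n]); split=> [|j|].
- exact: sos0.
- exact/sosC/ler0n.
- rewrite add0r (bigD1 i) //= eqxx mulr1 big1 ?addr0.
    exact: eq_sphere_refl.
  by move=> j /negbTE ij; rewrite eq_sym ij mulr0.
Qed.

Lemma Spi_moduleD f g : Spi_module f -> Spi_module g -> Spi_module (f + g).
Proof.
move=> [s0 [s [ss0 ss fs]]] [t0 [t [st0 st gt]]].
exists (s0 + t0), (fun i => s i + t i); split=> [|i|]; try exact: sosD.
under eq_bigr do rewrite mulrDr.
by rewrite big_split /= addrACA; apply: eq_sphereD.
Qed.

Lemma Spi_moduleM f g : sphere_sos f -> Spi_module g -> Spi_module (f * g).
Proof.
move=> [t st ft] [s0 [s [ss0 ss gs]]].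
exists (t * s0), (fun i => t * s i); split=> [|i|]; try exact: sosM.
under eq_bigr do rewrite mulrCA.
rewrite -mulr_sumr -mulrDr.
apply: (eq_sphere_trans (g := t * g)); last exact: eq_sphereMl.
by rewrite mulrC [t * g]mulrC; apply: eq_sphereMl.
Qed.

Lemma Spi_module_sum (I : Type) (r : seq I) (Q : pred I) (F : I -> {mpoly R[n]}) :
  (forall i, Q i -> Spi_module (F i)) -> Spi_module (\sum_(i <- r | Q i) F i).
Proof.
move=> sF; apply: big_ind => //; last exact: Spi_moduleD.
exact/Spi_moduleW/sphere_sosW/sos0.
Qed.

Lemma Spi_module_eval x f : Spi pi x -> Spi_module f -> 0 <= f.@[x].
Proof.
move=> [x0 x1] [s0 [s [ss0 ss /(eq_sphere_eval x1)->]]].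
rewrite mevalD raddf_sum addr_ge0 ?sos_eval ?sumr_ge0 // => i _.
by rewrite /= mevalM mevalXU mulr_ge0 ?sos_eval.
Qed.

End Sos.

(** * A Positivstellensatz on S^pi *)

Section Archimedean.
Context {R : realType} {n : nat} (pi : 'I_n -> R) (c : R).
Context (c_ge1 : 1 <= c) (c_pi : forall i, 1 <= c ^+ 2 * pi i).
Implicit Types (f g h : {mpoly R[n]}) (p : 'I_n -> R).
Local Notation nn := (normpi2_poly pi : {mpoly R[n]}).
Local Notation sphere_sos := (sphere_sos pi).
Local Notation Spi_module := (Spi_module pi).

Lemma sphere_sos_cancel (k : R) f :
  0 < k -> sphere_sos (k%:MP_[n] * f) -> sphere_sos f.
Proof.
move=> k0 skf; have -> : f = k^-1%:MP_[n] * (k%:MP_[n] * f).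
  by rewrite mulrA -mpolyCM mulVf ?gt_eqF // mpolyC1 mul1r.
by apply: sphere_sosM => //; apply: sphere_sosC; rewrite invr_ge0 ltW.
Qed.

(** On the sphere c^2 equals c^2 |x|_pi^2, and the choice of c makes every coefficient of the
    diagonal form c^2 |x|_pi^2 - x_i^2 nonnegative. *)
Lemma sphere_sos_coord_bound i : sphere_sos ((c ^+ 2)%:MP_[n] - 'X_i ^+ 2).
Proof.
have pi0 j : 0 <= c ^+ 2 * pi j by apply: le_trans (c_pi j).
exists (\sum_j (c ^+ 2 * pi j - (j == i)%:R)%:MP_[n] * 'X_j ^+ 2).
  apply: sos_sum => j _; apply: sosM; last exact: sos_sqr.
  apply: sosC; case: eqP => _; last by rewrite subr0.
  by rewrite subr_ge0.
exists (- (c ^+ 2)%:MP_[n]).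
have -> : \sum_j (c ^+ 2 * pi j - (j == i)%:R)%:MP_[n] * 'X_j ^+ 2 =
          (c ^+ 2)%:MP_[n] * nn - 'X_i ^+ 2 :> {mpoly R[n]}.
  under eq_bigr do rewrite mpolyCB mulrBl mpolyCM -mulrA.
  rewrite sumrB -mulr_sumr; congr (_ - _).
  rewrite (bigD1 i) //= eqxx mpolyC1 mul1r big1 ?addr0 // => j /negbTE->.
  by rewrite mpolyC0 mul0r.
by ring.
Qed.

(** 2c (c + x_i) = (c + x_i)^2 + (c^2 - x_i^2). The faces of the box thus lie in [sphere_sos], where
    products are allowed. *)
Lemma sphere_sos_boxD i : sphere_sos (c%:MP_[n] + 'X_i).
Proof.
have c1 := c_ge1; apply: (@sphere_sos_cancel (c *+ 2)); first lra.
have -> : (c *+ 2)%:MP_[n] * (c%:MP_[n] + 'X_i) =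
    (c%:MP_[n] + 'X_i) ^+ 2 + ((c ^+ 2)%:MP_[n] - 'X_i ^+ 2) by ring.
apply: sphere_sosD; [exact: sphere_sos_sqr|exact: sphere_sos_coord_bound].
Qed.

Lemma sphere_sos_boxB i : sphere_sos (c%:MP_[n] - 'X_i).
Proof.
have c1 := c_ge1; apply: (@sphere_sos_cancel (c *+ 2)); first lra.
have -> : (c *+ 2)%:MP_[n] * (c%:MP_[n] - 'X_i) =
    (c%:MP_[n] - 'X_i) ^+ 2 + ((c ^+ 2)%:MP_[n] - 'X_i ^+ 2) by ring.
apply: sphere_sosD; [exact: sphere_sos_sqr|exact: sphere_sos_coord_bound].
Qed.

(** * Lipschitz estimates certified by sums of squares *)

Definition box p := forall i, `|p i| <= c.

Definition dist2 p : {mpoly R[n]} := \sum_i ('X_i - (p i)%:MP_[n]) ^+ 2.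

Lemma sos_dist2 p : sos (dist2 p).
Proof. by apply: sos_sum => i _; apply: sos_sqr. Qed.

Lemma dist2_eval x p : (dist2 p).@[x] = \sum_i (x i - p i) ^+ 2.
Proof.
rewrite /dist2 raddf_sum; apply: eq_bigr => i _.
by rewrite /= rmorphXn /= mevalB mevalC mevalXU.
Qed.

(* A certified form of "h is bounded by sqrt C and sqrt C-Lipschitz", where
   the Lipschitz estimate compares any point of the sphere with any point of
   the box. *)
Definition lip (C : R) h :=
  [/\ 0 <= C, forall p, box p -> h.@[p] ^+ 2 <= C,
      sphere_sos (C%:MP_[n] - h ^+ 2) &
      forall p, box p ->
        sphere_sos (C%:MP_[n] * dist2 p - (h - (h.@[p])%:MP_[n]) ^+ 2)].

Lemma lip_cst (a : R) : lip (a ^+ 2) a%:MP_[n].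
Proof.
split=> [|p _||p _]; first exact: sqr_ge0.
- by rewrite mevalC.
- by rewrite rmorphXn subrr -mpolyC0; apply: sphere_sosC.
- rewrite mevalC subrr expr0n subr0; apply: sphere_sosM.
    exact/sphere_sosC/sqr_ge0.
  exact/sphere_sosW/sos_dist2.
Qed.

Lemma lip_X i : lip (c ^+ 2) 'X_i.
Proof.
split=> [|p bp||p bp]; first exact: sqr_ge0.
- by rewrite mevalXU -real_normK ?num_real // lerXn2r ?nnegrE // ?(le_trans _ (bp i)).
- exact: sphere_sos_coord_bound.
- rewrite mevalXU /dist2 mulr_sumr (bigD1 i) //= addrAC.
  apply: sphere_sosD; last first.
    apply: sphere_sos_sum => j _; apply: sphere_sosM; last exact: sphere_sos_sqr.
    exact/sphere_sosC/sqr_ge0.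
  set d := 'X_i - _.
  have -> : (c ^+ 2)%:MP_[n] * d ^+ 2 - d ^+ 2 = (c ^+ 2 - 1)%:MP_[n] * d ^+ 2.
    by ring.
  apply: sphere_sosM; last exact: sphere_sos_sqr.
  by apply: sphere_sosC; rewrite subr_ge0; have := c_ge1; nra.
Qed.

(** Both certificates come from the parallelogram identity 2a^2 + 2b^2 = (a + b)^2 + (a - b)^2. *)
Lemma lip_add C D h k : lip C h -> lip D k -> lip (C *+ 2 + D *+ 2) (h + k).
Proof.
move=> [C0 hb hs hl] [D0 kb ks kl]; split=> [|p bp||p bp].
- by rewrite addr_ge0 // mulrn_wge0.
- rewrite mevalD.
  have := hb p bp; have := kb p bp.
  have := sqr_ge0 (h.@[p] - k.@[p]); nra.
- have -> : (C *+ 2 + D *+ 2)%:MP_[n] - (h + k) ^+ 2 =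
    2%:MP_[n] * (C%:MP_[n] - h ^+ 2) + 2%:MP_[n] * (D%:MP_[n] - k ^+ 2)
    + (h - k) ^+ 2 by ring.
  apply: sphere_sosD; last exact: sphere_sos_sqr.
  by apply: sphere_sosD; apply: sphere_sosM => //; apply: sphere_sosC.
- rewrite mevalD.
  set hp := h.@[p] in hl *; set kp := k.@[p] in kl *.
  have -> : (C *+ 2 + D *+ 2)%:MP_[n] * dist2 p - (h + k - (hp + kp)%:MP_[n]) ^+ 2 =
    2%:MP_[n] * (C%:MP_[n] * dist2 p - (h - hp%:MP_[n]) ^+ 2)
    + 2%:MP_[n] * (D%:MP_[n] * dist2 p - (k - kp%:MP_[n]) ^+ 2)
    + ((h - hp%:MP_[n]) - (k - kp%:MP_[n])) ^+ 2 by ring.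
  apply: sphere_sosD; last exact: sphere_sos_sqr.
  apply: sphere_sosD; apply: sphere_sosM; try exact: sphere_sosC.
    exact: hl.
  exact: kl.
Qed.

(** Split hk - h(p)k(p) as (h - h(p)) k + h(p) (k - k(p)) and use the parallelogram identity. The
    bound on k over the sphere and the bound on h at p, both part of [lip], control the two
    squares. *)
Lemma lip_mul C D h k : lip C h -> lip D k -> lip (C * D *+ 4) (h * k).
Proof.
move=> [C0 hb hs hl] [D0 kb ks kl].
have CD0 : 0 <= C * D by rewrite mulr_ge0.
have sC := sphere_sosC pi C0; have sD := sphere_sosC pi D0.
have s2 : sphere_sos 2%:MP_[n] by apply: sphere_sosC.
split=> [|p bp||p bp].
- by rewrite mulrn_wge0.
- rewrite mevalM exprMn (@le_trans _ _ (C * D)) ?ler_pM ?sqr_ge0 ?hb ?kb //; lra.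
- have -> : (C * D *+ 4)%:MP_[n] - (h * k) ^+ 2 =
    3%:MP_[n] * (C%:MP_[n] * D%:MP_[n])
    + C%:MP_[n] * (D%:MP_[n] - k ^+ 2) + k ^+ 2 * (C%:MP_[n] - h ^+ 2) by ring.
  apply: sphere_sosD; first apply: sphere_sosD; apply: sphere_sosM => //.
  + exact: sphere_sosC.
  + exact: sphere_sosM.
  + exact: sphere_sos_sqr.
- rewrite mevalM.
  have := hb p bp; have {}hl := hl p bp; have {}kl := kl p bp.
  set hp := h.@[p] in hl *; set kp := k.@[p] in kl * => hpC.
  have -> : (C * D *+ 4)%:MP_[n] * dist2 p - (h * k - (hp * kp)%:MP_[n]) ^+ 2 =
    2%:MP_[n] * (D%:MP_[n] * (C%:MP_[n] * dist2 p - (h - hp%:MP_[n]) ^+ 2)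
                 + (D%:MP_[n] - k ^+ 2) * (h - hp%:MP_[n]) ^+ 2)
    + 2%:MP_[n] * (hp%:MP_[n] ^+ 2 * (D%:MP_[n] * dist2 p - (k - kp%:MP_[n]) ^+ 2)
                 + (C - hp ^+ 2)%:MP_[n] * (D%:MP_[n] * dist2 p))
    + ((h - hp%:MP_[n]) * k - hp%:MP_[n] * (k - kp%:MP_[n])) ^+ 2 by ring.
  have sq := sphere_sos_sqr pi.
  apply: sphere_sosD; last exact: sq.
  apply: sphere_sosD; apply: sphere_sosM => //; apply: sphere_sosD;
    apply: sphere_sosM => //; [|apply: sphere_sosM => //].
    by apply: sphere_sosC; rewrite subr_ge0.
  exact/sphere_sosW/sos_dist2.
Qed.

Lemma lip_ex h : exists C, lip C h.
Proof.
move: h; apply: mpoly_alg_ind => [a|i|h k [C hC] [D kD]|h k [C hC] [D kD]].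
- by exists (a ^+ 2); apply: lip_cst.
- by exists (c ^+ 2); apply: lip_X.
- by exists (C *+ 2 + D *+ 2); apply: lip_add.
- by exists (C * D *+ 4); apply: lip_mul.
Qed.

Lemma lip_dist C h p x : lip C h -> box p -> normpi2 pi x = 1 ->
  (h.@[x] - h.@[p]) ^+ 2 <= C * \sum_i (x i - p i) ^+ 2.
Proof.
move=> [_ _ _ hl] bp x1; have /(sphere_sos_eval x1) := hl p bp.
by rewrite mevalB mevalM mevalC rmorphXn /= mevalB mevalC dist2_eval subr_ge0.
Qed.

(** With t = h - h(p), the Lipschitz estimate and (t + 2e)^2 >= 0 give C dist2 / (4e) >= t^2 / (4e)
    >= - t - e, so the sum is at least h(p) - e >= e. *)
Lemma lip_lower C h p (e : R) : lip C h -> box p -> 0 < e -> e *+ 2 <= h.@[p] ->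
  sphere_sos (h + (C / (e *+ 4))%:MP_[n] * dist2 p - e%:MP_[n]).
Proof.
move=> [_ _ _ hl] bp e0; have {}hl := hl p bp; move: hl.
set hp := h.@[p] => hl ehp; apply: (@sphere_sos_cancel (e *+ 4)); first lra.
have -> : (e *+ 4)%:MP_[n] * (h + (C / (e *+ 4))%:MP_[n] * dist2 p - e%:MP_[n])
  = (C%:MP_[n] * dist2 p - (h - hp%:MP_[n]) ^+ 2)
    + (h - hp%:MP_[n] + (e *+ 2)%:MP_[n]) ^+ 2
    + (e *+ 4)%:MP_[n] * (hp - e *+ 2)%:MP_[n].
  have eC : e *+ 4 * (C / (e *+ 4)) = C by field; rewrite gt_eqF.
  by rewrite mulrBr mulrDr mulrA -[_ * (C / _)%:MP_[n]]mpolyCM eC; ring.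
apply: sphere_sosD; first apply: sphere_sosD => //; first exact: sphere_sos_sqr.
by apply: sphere_sosM; apply: sphere_sosC; lra.
Qed.

(** * The Bernstein partition of unity on the box *)

Definition baryc i : {mpoly R[n]} := (c *+ 2)^-1%:MP_[n] * ('X_i + c%:MP_[n]).

Lemma sphere_sos_baryc i : sphere_sos (baryc i).
Proof.
apply: sphere_sosM; last by rewrite addrC; apply: sphere_sos_boxD.
by apply: sphere_sosC; rewrite invr_ge0; have := c_ge1; lra.
Qed.

Lemma c2_unit : (c *+ 2)^-1 * (c *+ 2) = 1.
Proof. by rewrite mulVf // mulrn_eq0 /= gt_eqF //; have := c_ge1; lra. Qed.

Lemma baryc_compl i : 1 - baryc i = (c *+ 2)^-1%:MP_[n] * (c%:MP_[n] - 'X_i).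
Proof.
rewrite /baryc -mpolyC1 -c2_unit; ring.
Qed.

Lemma sphere_sos_baryc_compl i : sphere_sos (1 - baryc i).
Proof.
rewrite baryc_compl; apply: sphere_sosM; last exact: sphere_sos_boxB.
by apply: sphere_sosC; rewrite invr_ge0; have := c_ge1; lra.
Qed.

(* Averages over the Bernstein partition of unity, one step of the binomial
   random walk at a time: from position j with m steps left in direction i, the
   expected value of (final position - N u)^2 is the F j m i of the proof. *)
Lemma bernstein_walk g a N :
  (forall j : 'I_n -> nat, (forall i, j i <= N)%N ->
     Spi_module (g + a * \sum_i ((j i)%:R - N%:R * baryc i) ^+ 2)) ->
  Spi_module (g + a * \sum_i N%:R * baryc i * (1 - baryc i)).
Proof.
move=> base.
pose F (j m : nat) i : {mpoly R[n]} :=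
  (j%:R + m%:R * baryc i - N%:R * baryc i) ^+ 2 + m%:R * baryc i * (1 - baryc i).
suff walk k (j m : 'I_n -> nat) : (\sum_i m i = k)%N ->
    (forall i, j i + m i <= N)%N ->
    Spi_module (g + a * \sum_i F (j i) (m i) i).
  have := walk _ (fun=> 0%N) (fun=> N) erefl (fun=> leqnn N).
  rewrite (eq_bigr (fun i => N%:R * baryc i * (1 - baryc i))) // => i _.
  by rewrite /F; ring.
elim: k j m => [|k IHk] j m mk jmN.
  rewrite (eq_bigr (fun i => ((j i)%:R - N%:R * baryc i) ^+ 2)).
    by apply: base => i; apply: leq_trans (jmN i); apply: leq_addr.
  move=> i _; have /eqP := mk; rewrite sum_nat_eq0 => /forallP/(_ i)/eqP mi0.
  by rewrite /F mi0; ring.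
have [i0 mi0] : exists i0, (0 < m i0)%N.
  apply/existsP; apply: contraT; rewrite negb_exists => /forallP m0.
  move: mk; rewrite big1 // => i _; apply/eqP.
  by have := m0 i; rewrite lt0n negbK.
pose m' i := if i == i0 then (m i).-1 else m i.
pose j' i := if i == i0 then (j i).+1 else j i.
have m'k : (\sum_i m' i = k)%N.
  move: mk; rewrite !(bigD1 i0 (P := predT)) //= {1}/m' eqxx => mk.
  rewrite (eq_bigr m) => [|i /negbTE ii0]; last by rewrite /m' ii0.
  by move: mk; rewrite -(prednK mi0) addSn => -[].
(* Condition on the next step in direction i0: with weight [baryc i0] the position advances, with
   the complementary weight it stays. *)
have -> : g + a * (\sum_i F (j i) (m i) i) =
    baryc i0 * (g + a * \sum_i F (j' i) (m' i) i)
    + (1 - baryc i0) * (g + a * \sum_i F (j i) (m' i) i).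
  rewrite !(bigD1 i0 (P := predT)) //= /j' /m' eqxx.
  have e1 : \sum_(i | i != i0) F (if i == i0 then (j i).+1 else j i)
      (if i == i0 then (m i).-1 else m i) i = \sum_(i | i != i0) F (j i) (m i) i.
    by apply: eq_bigr => i /negbTE->.
  have e2 : \sum_(i | i != i0) F (j i)
      (if i == i0 then (m i).-1 else m i) i = \sum_(i | i != i0) F (j i) (m i) i.
    by apply: eq_bigr => i /negbTE->.
  rewrite e1 e2; set r := \sum_(i | _) _.
  case: (m i0) mi0 => // mi _ /=; rewrite /F -[mi.+1]addn1 -[(j i0).+1]addn1 !natrD.
  by ring.
have jm'N i : (j' i + m' i <= N)%N.
  rewrite /j' /m'; case: eqP => [->|_]; last exact: jmN.
  by rewrite addSnnS prednK.
apply: Spi_moduleD; apply: Spi_moduleM.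
- exact: sphere_sos_baryc.
- exact: IHk.
- exact: sphere_sos_baryc_compl.
- apply: IHk => // i; apply: leq_trans (jmN i); rewrite leq_add2l /m'.
  by case: eqP => // _; apply: leq_pred.
Qed.

(** * Lower bounds around the points of the box *)

Lemma lip_le C D h : C <= D -> lip C h -> lip D h.
Proof.
move=> CD [C0 hb hs hl]; split=> [|p bp||p bp].
- exact: le_trans CD.
- exact: le_trans (hb p bp) CD.
- rewrite (_ : _ - _ = (D - C)%:MP_[n] + (C%:MP_[n] - h ^+ 2)); last by ring.
  by apply: sphere_sosD => //; apply: sphere_sosC; rewrite subr_ge0.
- set d := h - _.
  rewrite (_ : _ - _ = (D - C)%:MP_[n] * dist2 p + (C%:MP_[n] * dist2 p - d ^+ 2)).
    apply: sphere_sosD; last exact: hl.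
    apply: sphere_sosM; first by apply: sphere_sosC; rewrite subr_ge0.
    exact/sphere_sosW/sos_dist2.
  by ring.
Qed.

Lemma sphere_coord_le x i : normpi2 pi x = 1 -> `|x i| <= c.
Proof.
move=> x1; have /(sphere_sos_eval x1) := sphere_sos_coord_bound i.
rewrite mevalB mevalC rmorphXn /= mevalXU subr_ge0 -(real_normK (num_real (x i))).
by rewrite ler_pXn2r // nnegrE; apply: le_trans c_ge1.
Qed.

(** Take x = |p| / |p|_pi coordinatewise. Rescaling moves a coordinate by at most c e, and removing
    a negative sign by at most 2e. *)
Lemma near_Spi p (e : R) : box p -> 0 < e <= 1 / 2 ->
  (forall i, - e <= p i) -> `|normpi2 pi p - 1| <= e ->
  exists2 x, Spi pi x & forall i, `|x i - p i| <= (c + 2) * e.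
Proof.
move=> bp /andP[e0 e1] pe; rewrite ler_distl => /andP[n0 n1].
have np0 : 0 < normpi2 pi p by lra.
pose r := Num.sqrt (normpi2 pi p).
have r2 : r ^+ 2 = normpi2 pi p by rewrite sqr_sqrtr // ltW.
have r0 : 0 < r by rewrite sqrtr_gt0.
pose x i := `|p i| / r; have xS : Spi pi x := Spi_normalize np0.
have x1 : normpi2 pi x = 1 by case: xS.
exists x => // i; have xc := sphere_coord_le i x1.
have xi0 : 0 <= x i by rewrite divr_ge0 // ltW.
have xr : x i * r = `|p i| by rewrite divfK // gt_eqF.
have r1 : `|1 - r| <= e.
  have : `|1 - r| * (1 + r) <= e.
    have r10 : 0 <= 1 + r by lra.
    by rewrite -(ger0_norm r10) -normrM ler_norml; apply/andP; split; nra.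
  have := normr_ge0 (1 - r); nra.
rewrite (_ : x i - p i = x i * (1 - r) + (`|p i| - p i)); last by rewrite -xr; ring.
apply: le_trans (ler_normD _ _) _; rewrite mulrDl lerD //.
  by rewrite normrM ler_pM.
have := pe i; case: (lerP 0 (p i)) => pi0 pie.
  by rewrite (ger0_norm pi0) subrr normr0 mulr_ge0 // ltW.
by rewrite (ltr0_norm pi0) ger0_norm; lra.
Qed.

(** The constant does not depend on p, so the grid can be refined once it is known. *)
Lemma node_lower g (eta : R) : 0 < eta ->
  (forall x, Spi pi x -> eta <= g.@[x]) ->
  exists2 C : R, 0 <= C & forall p, box p ->
    Spi_module (g + C%:MP_[n] * dist2 p - (eta / 4)%:MP_[n]).
Proof.
move=> eta0 geta; have c1 := c_ge1.
have [C gC] := lip_ex g; have [C0 gb _ _] := gC.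
pose A := n%:R * (c + 2) ^+ 2.
have A0 : 0 <= A by rewrite mulr_ge0 // sqr_ge0.
(* B and e make C A e^2 <= (B e)^2 = (eta / 2)^2: between p and a point of S^pi with coordinates
   within (c + 2) e, the value of g changes by at most eta / 2. *)
pose B := 1 + C * A + eta.
have B1 : 1 <= B by rewrite /B; have := mulr_ge0 C0 A0; lra.
pose e := eta / (B *+ 2).
have eB : e * B = eta / 2 by rewrite /e; field; rewrite gt_eqF //; lra.
have e0 : 0 < e by rewrite divr_gt0 //; lra.
have e1 : e <= 1 / 2.
  have etaB : eta <= B by rewrite /B; have := mulr_ge0 C0 A0; lra.
  by rewrite -(ler_pM2r (lt_le_trans ltr01 B1)) eB; lra.
(* D outweighs the lower bound - (1 + C) of g on the box: a coordinate below - e, or a norm defect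
   above e, then leaves a value of at least eta. *)
pose D := (1 + C + eta) / e ^+ 2.
have De : D * e ^+ 2 = 1 + C + eta by rewrite divfK // expf_neq0 // gt_eqF.
have D0 : 0 <= D by rewrite divr_ge0 ?sqr_ge0 //; lra.
have De1 : 1 + C + eta <= D * e by rewrite -De; nra.
have [C2 hC2] := lip_ex (g + D%:MP_[n] * (nn - 1) ^+ 2).
pose C1 := C *+ 2 + ((- D) ^+ 2 * c ^+ 2 *+ 4) *+ 2.
have hC1 i : lip C1 (g + (- D)%:MP_[n] * 'X_i).
  by apply: lip_add => //; apply: lip_mul; [apply: lip_cst|apply: lip_X].
have C10 : 0 <= C1.
  by rewrite /C1 addr_ge0 ?mulrn_wge0 // mulr_ge0 ?sqr_ge0.
have C20 : 0 <= C2 by case: hC2.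
pose E := C + C1 + C2.
have EC : C <= E /\ C1 <= E /\ C2 <= E.
  split; first by rewrite /E -addrA lerDl addr_ge0.
  by split; [rewrite /E addrAC|rewrite /E]; rewrite lerDr addr_ge0.
have E0 : 0 <= E / ((eta / 4) *+ 4).
  by apply: divr_ge0; [apply: le_trans EC.1|lra].
exists (E / ((eta / 4) *+ 4)) => // p bp.
have lower h : lip E h -> (eta / 4) *+ 2 <= h.@[p] ->
    sphere_sos (h + (E / ((eta / 4) *+ 4))%:MP_[n] * dist2 p - (eta / 4)%:MP_[n]).
  by move=> hE he; apply: lip_lower => //; lra.
set S := _ * dist2 p in lower *.
have gp : - (1 + C) <= g.@[p] by have := gb p bp; nra.
have [/forallP pe|] := boolP [forall i, - e <= p i]; last first.
  rewrite negb_forall => /existsP[i]; rewrite -ltNge => pie.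
  rewrite (_ : g + S - (eta / 4)%:MP_[n] = D%:MP_[n] * 'X_i +
    (g + (- D)%:MP_[n] * 'X_i + S - (eta / 4)%:MP_[n])); last by ring.
  apply: Spi_moduleD; first by apply: Spi_moduleM;
    [apply: sphere_sosC|apply: Spi_moduleX].
  apply/Spi_moduleW/lower; first by apply: lip_le (hC1 i); case: EC => _ [].
  rewrite mevalD mevalM mevalC mevalXU.
  have : D * e <= D * - p i by rewrite ler_wpM2l //; lra.
  lra.
have [np|] := lerP `|normpi2 pi p - 1| e; last first.
  move=> np; apply: (@Spi_module_eq _ _ _ _
    (g + D%:MP_[n] * (nn - 1) ^+ 2 + S - (eta / 4)%:MP_[n])).
    by exists (- D%:MP_[n] * (nn - 1)); ring.
  apply/Spi_moduleW/lower; first by apply: lip_le hC2; case: EC => _ [].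
  rewrite mevalD mevalM mevalC rmorphXn /= mevalB meval1 normpi2_poly_eval.
  have : D * e ^+ 2 <= D * (normpi2 pi p - 1) ^+ 2.
    rewrite ler_wpM2l // -[(_ - 1) ^+ 2]real_normK ?num_real //.
    by rewrite ler_pXn2r ?nnegrE // ltW.
  lra.
have [x xS xp] := near_Spi bp (introT andP (conj e0 e1)) pe np.
apply/Spi_moduleW/lower; first by apply: lip_le gC; case: EC.
have gx := geta _ xS; case: xS => _ /(lip_dist gC bp) gxp.
have {}gxp : (g.@[x] - g.@[p]) ^+ 2 <= (eta / 2) ^+ 2.
  apply: le_trans gxp _; apply: (@le_trans _ _ (C * (A * e ^+ 2))).
    rewrite ler_wpM2l // -mulrA -exprMn.
    rewrite -[X in X%:R]card_ord -sum1_card natr_sum mulr_suml.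
    apply: ler_sum => i _; rewrite mul1r -real_normK ?num_real //.
    by rewrite ler_pXn2r ?nnegrE // mulr_ge0 //; lra.
  rewrite -eB mulrA [(e * B) ^+ 2]exprMn [leRHS]mulrC ler_wpM2r ?sqr_ge0 //.
  by have CAB : C * A <= B; [rewrite /B; lra|nra].
nra.
Qed.

(** Averaging the node bounds with Bernstein weights turns [C dist2 p] into C times the variance of
    a rescaled binomial walk, which tends to 0 as the mesh shrinks and is absorbed by the margin
    e. *)
Lemma putinar_Spi g (eta : R) : 0 < eta ->
  (forall x, Spi pi x -> eta <= g.@[x]) -> Spi_module g.
Proof.
move=> eta0 geta; have c1 := c_ge1.
have [C C0 node] := node_lower eta0 geta.
set e := eta / 4 in node.
have e0 : 0 < e by rewrite /e; lra.
(* Since u (1 - u) <= 1/4, the variance term is at most C c^2 n / N, which this N puts below e. *)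
pose N := (Num.trunc (C * c ^+ 2 * n%:R / e)).+1.
have Ngt : C * c ^+ 2 * n%:R / e < N%:R.
  exact: truncnS_gt.
have N0 : 0 < N%:R :> R by rewrite ltr0n.
(* The grid spacing is 2c / N, so [a] converts squared integer displacements of the walk into C
   times squared distances. *)
pose a := C * (c *+ 2) ^+ 2 / N%:R ^+ 2.
have aN : a * N%:R = C * (c *+ 2) ^+ 2 / N%:R.
  by rewrite /a; field; rewrite gt_eqF.
have aN0 : 0 <= a * N%:R.
  rewrite aN; apply: divr_ge0; last exact: ltW.
  by apply: mulr_ge0; last exact: sqr_ge0.
have step : Spi_module (g - e%:MP_[n] + a%:MP_[n] *
    \sum_i N%:R * baryc i * (1 - baryc i)).
  apply: bernstein_walk => j jN.
  pose p i : R := c *+ 2 * ((j i)%:R / N%:R) - c.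
  have bp : box p.
    move=> i; have j1 : (j i)%:R / N%:R <= 1 :> R.
      by rewrite ler_pdivrMr // mul1r ler_nat.
    have j0 : 0 <= (j i)%:R / N%:R :> R by rewrite divr_ge0 // ltW.
    rewrite /p ler_norml; nra.
  have := node p bp.
  rewrite (_ : g + _ - _ = g - e%:MP_[n] + C%:MP_[n] * dist2 p); last by ring.
  rewrite (_ : C%:MP_[n] * dist2 p =
     a%:MP_[n] * \sum_i ((j i)%:R - N%:R * baryc i) ^+ 2) //.
  rewrite /dist2 !mulr_sumr; apply: eq_bigr => i _.
  have -> : a%:MP_[n] * ((j i)%:R - N%:R * baryc i) ^+ 2 =
      C%:MP_[n] * (((c *+ 2) / N%:R)%:MP_[n] * ((j i)%:R - N%:R * baryc i)) ^+ 2.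
    have -> : a = C * ((c *+ 2) / N%:R) ^+ 2 by rewrite expr_div_n mulrA.
    by set b := _ / _; ring.
  congr (_ * _); rewrite -[in RHS]sqrrN; congr (_ ^+ 2).
  have e1 : c *+ 2 / N%:R * N%:R * (c *+ 2)^-1 = 1.
    by field; rewrite !gt_eqF //; lra.
  transitivity ((c *+ 2 / N%:R * N%:R * (c *+ 2)^-1)%:MP_[n] * ('X_i + c%:MP_[n])
      - (c *+ 2 * ((j i)%:R / N%:R))%:MP_[n]); first by rewrite e1 /p; ring.
  by rewrite /baryc; ring.
(* The variance is removed through u (1 - u) = 1/4 - (u - 1/2)^2, which leaves a nonnegative
   constant and squares. *)
apply: (@Spi_module_eq _ _ _ _ (g - e%:MP_[n] + a%:MP_[n] *
    (\sum_i N%:R * baryc i * (1 - baryc i)) +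
    ((e - a * N%:R * (n%:R / 4))%:MP_[n] +
      \sum_i (a * N%:R)%:MP_[n] * (baryc i - (2^-1)%:MP_[n]) ^+ 2))).
  rewrite (_ : _ + (_ + _) = g); first exact: eq_sphere_refl.
  have -> : \sum_i (a * N%:R)%:MP_[n] * (baryc i - (2^-1)%:MP_[n]) ^+ 2 =
      (a * N%:R * (n%:R / 4))%:MP_[n]
      - a%:MP_[n] * \sum_i N%:R * baryc i * (1 - baryc i).
    apply/eqP; rewrite eq_sym subr_eq; apply/eqP.
    rewrite -[X in X%:R / 4]card_ord -sum1_card natr_sum mulr_suml !mulr_sumr rmorph_sum.
    rewrite -big_split; apply: eq_bigr => i _ /=.
    have h4 : (1 / 4 : R) = 2^-1 * 2^-1 by field.
    set hf : {mpoly R[n]} := (2^-1)%:MP_[n].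
    have h2 : hf + hf = 1 by rewrite -mpolyCD -mpolyC1; congr _%:MP_[n]; field.
    transitivity ((a * N%:R)%:MP_[n] * (hf ^+ 2 + baryc i * (1 - (hf + hf)))).
      by rewrite h2 h4 /hf; ring.
    by ring.
  by ring.
apply: Spi_moduleD => //; apply/Spi_moduleW/sphere_sosD.
  apply: sphere_sosC; rewrite aN.
  move: Ngt; rewrite ltr_pdivrMr // => Ngt.
  rewrite subr_ge0 mulrAC ler_pdivrMr //.
  rewrite [e * _]mulrC; apply: le_trans (ltW Ngt).
  by rewrite le_eqVlt; apply/orP; left; apply/eqP; field.
apply: sphere_sos_sum => i _; apply: sphere_sosM; last exact: sphere_sos_sqr.
exact: sphere_sosC.
Qed.

End Archimedean.

(** * Positive semidefinite forms *)

Section PositiveSemidefinite.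
Context {R : realType} {n : nat}.
Implicit Types (a : 'I_n -> 'I_n -> R) (v : 'I_n -> R).

Definition quadform a v : R := \sum_i \sum_j a i j * v i * v j.

Lemma quadform_shift a v (t : R) k : (forall i j, a i j = a j i) ->
  quadform a (fun i => v i + t * (i == k)%:R) =
  quadform a v + t *+ 2 * (\sum_j a k j * v j) + t ^+ 2 * a k k.
Proof.
move=> asym; rewrite /quadform.
have delta (F : 'I_n -> R) : \sum_i F i * (i == k)%:R = F k.
  rewrite (bigD1 k) //= eqxx mulr1 big1 ?addr0 // => i /negbTE->.
  by rewrite mulr0.
have inner i : \sum_j a i j * (v i + t * (i == k)%:R) * (v j + t * (j == k)%:R) =
    (\sum_j a i j * v i * v j) + t * (a i k * v i)
    + (t * \sum_j a i j * v j + t ^+ 2 * a i k) * (i == k)%:R.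
  rewrite -[a i k](delta (a i)) mulr_suml !mulr_sumr -!big_split mulr_suml -big_split.
  by apply: eq_bigr => j _ /=; ring.
under eq_bigr do rewrite inner.
rewrite !big_split /= delta -mulr_sumr.
have -> : \sum_i a i k * v i = \sum_j a k j * v j.
  by apply: eq_bigr => i _; rewrite asym.
by ring.
Qed.

(** Along the k-th axis through the j-th basis vector the form is affine with slope 2 [a k j]; a
    nonzero slope would produce the value - 1. *)
Lemma psd_row0 a k : (forall i j, a i j = a j i) -> (forall v, 0 <= quadform a v) ->
  a k k = 0 -> forall j, a k j = 0.
Proof.
move=> asym apsd akk j; pose v i : R := (i == j)%:R.
have akv : \sum_i a k i * v i = a k j.
  rewrite (bigD1 j) //= /v eqxx mulr1 big1 ?addr0 // => i /negbTE->.
  by rewrite mulr0.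
have shift t : 0 <= quadform a v + t *+ 2 * a k j.
  have := apsd (fun i => v i + t * (i == k)%:R).
  by rewrite quadform_shift // akv akk mulr0 addr0.
apply/eqP; apply: contraT => akj.
have := shift (- (quadform a v + 1) / (a k j *+ 2)).
rewrite (_ : _ *+ 2 * _ = - (quadform a v + 1)); first lra.
by field.
Qed.

(** Cholesky elimination from the last row down: rows of index at least k already vanish. A zero
    pivot has a zero row by [psd_row0]. *)
Lemma psd_gram a : (forall i j, a i j = a j i) -> (forall v, 0 <= quadform a v) ->
  exists Ls : seq ('I_n -> R), forall i j, a i j = \sum_(L <- Ls) L i * L j.
Proof.
suff gram k : (forall i j, a i j = a j i) -> (forall v, 0 <= quadform a v) ->
    (forall i j : 'I_n, (k <= i)%N -> a i j = 0) ->
    exists Ls : seq ('I_n -> R), forall i j, a i j = \sum_(L <- Ls) L i * L j.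
  by move=> asym apsd; apply: (gram n) => // i j; rewrite leqNgt ltn_ord.
elim: k a => [|k IHk] a asym apsd a0.
  by exists [::] => i j; rewrite big_nil a0.
case: (ltnP k n) => [kn|nk]; last first.
  by apply: IHk => // i j ki; apply: a0; have := leq_trans nk ki; rewrite leqNgt ltn_ord.
pose k0 := Ordinal kn.
have a0' (b : 'I_n -> 'I_n -> R) : (forall j, b k0 j = 0) ->
    (forall i j : 'I_n, (k < i)%N -> b i j = 0) ->
    forall i j : 'I_n, (k <= i)%N -> b i j = 0.
  move=> bk b0 i j; rewrite leq_eqVlt => /orP[/eqP ki|]; last exact: b0.
  by have -> : i = k0 by apply: val_inj.
have [akk|akk] := eqVneq (a k0 k0) 0.
  by apply: IHk => //; apply: a0' => //; apply: psd_row0.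
have akk0 : 0 < a k0 k0.
  rewrite lt_neqAle eq_sym akk /=.
  have := apsd (fun i => 0 + 1 * (i == k0)%:R).
  rewrite quadform_shift // /quadform big1 => [|i _]; last first.
    by rewrite big1 // => j _; rewrite !mulr0.
  rewrite big1 => [|j _]; last by rewrite mulr0.
  by rewrite mulr0 !add0r expr1n mul1r.
pose b i j := a i j - a i k0 * a k0 j / a k0 k0.
have [|||Ls bL] := IHk b.
- by move=> i j; rewrite /b asym (asym i k0) (asym k0 j) [a k0 i * _]mulrC.
(* The Schur complement at v is the value of [a] at the minimizer along the [k0] axis, hence
   nonnegative. *)
- move=> v; pose s := \sum_j a k0 j * v j.
  have := apsd (fun i => v i + (- s / a k0 k0) * (i == k0)%:R).
  rewrite quadform_shift // -/s.
  have -> : quadform b v = quadform a v - s * s / a k0 k0.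
    rewrite /quadform {1}/s mulrAC mulr_suml mulr_suml -sumrB.
    apply: eq_bigr => i _; rewrite /s.
    rewrite mulr_sumr -sumrB; apply: eq_bigr => j _.
    by rewrite /b (asym i k0); ring.
  by congr (_ <= _); field.
- apply: a0' => [j|i j ki]; rewrite /b; last by rewrite (a0 i j ki) (a0 i k0 ki) !mul0r subr0.
  by field.
exists ((fun i => a i k0 / Num.sqrt (a k0 k0)) :: Ls) => i j.
rewrite big_cons -bL /b mulrACA -invfM -expr2 sqr_sqrtr ?ltW // (asym j k0).
by ring.
Qed.

End PositiveSemidefinite.

(** * From local to global certificates *)

Lemma expr_small {R : realType} (r e : R) : 0 <= r < 1 -> 0 < e ->
  exists m0, forall m, (m0 <= m)%N -> r ^+ m <= e.
Proof.
move=> /andP[r0 r1] e0.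
(* The left side decreases in m: the ratio step reduces to (m + 1) (1 - r)^2 >= 0. *)
have bern m : r ^+ m * (1 + m%:R * (1 - r)) <= 1.
  elim: m => [|m IHm]; first by rewrite expr0 mul0r addr0 mulr1.
  apply: le_trans IHm; rewrite exprS mulrAC [leLHS]mulrC.
  rewrite ler_wpM2l ?exprn_ge0 // -natr1.
  have : 0 <= (m%:R + 1) * (1 - r) ^+ 2 by rewrite mulr_ge0 ?sqr_ge0 ?addr_ge0.
  nra.
exists (Num.trunc (e^-1 / (1 - r))).+1 => m mm.
have mr : e^-1 <= m%:R * (1 - r).
  rewrite -ler_pdivrMr ?subr_gt0 // ltW // (lt_le_trans (truncnS_gt _)) //.
  by rewrite ler_nat.
have re : r ^+ m * e^-1 <= 1.
  apply: le_trans (bern m); rewrite ler_wpM2l ?exprn_ge0 //; lra.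
by move: re; rewrite ler_pdivrMr // mul1r.
Qed.

Section LocalGlobal.
Context {R : realType} {n : nat} (pi : 'I_n -> R) (c : R).
Context (c_ge1 : 1 <= c) (c_pi : forall i, 1 <= c ^+ 2 * pi i).
Implicit Types (f g h : {mpoly R[n]}).
Local Notation nn := (normpi2_poly pi : {mpoly R[n]}).
Local Notation one := (fun _ : 'I_n => 1 : R).
Local Notation q := (@dist2 R n one).

Lemma box_one : box c one.
Proof. by move=> i; rewrite normr1. Qed.

(** Provides w = 1 - q / Q with a certificate and w >= 1/2 on S^pi. The bound C on q^2 gives the
    bound 1 + C on q, and Q is twice that. *)
Lemma dist2_bound : exists2 Q : R, 2 <= Q &
  sphere_sos pi (1 - Q^-1%:MP_[n] * q) /\
  forall x, Spi pi x -> Q^-1 * (q).@[x] <= 1 / 2.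
Proof.
have [C qC] := lip_ex c_ge1 c_pi q; have [C0 _ Cq _] := qC.
have sCq : sphere_sos pi ((1 + C)%:MP_[n] - q).
  have -> : (1 + C)%:MP_[n] - q = (C%:MP_[n] - q ^+ 2)
      + (q - (2^-1)%:MP_[n]) ^+ 2 + (3 / 4)%:MP_[n].
    set hf : {mpoly R[n]} := (2^-1)%:MP_[n].
    have h2 : hf + hf = 1 by rewrite -mpolyCD -mpolyC1; congr _%:MP_[n]; field.
    have h3 : (3 / 4)%:MP_[n] = 1 - hf ^+ 2 :> {mpoly R[n]}.
      by rewrite -rmorphXn -mpolyC1 -mpolyCB; congr _%:MP_[n]; field.
    transitivity (C%:MP_[n] + 1 - (hf + hf) * q); first by rewrite h2; ring.
    by rewrite h3; ring.
  apply: sphere_sosD; last by apply: sphere_sosC; lra.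
  by apply: sphere_sosD => //; apply: sphere_sos_sqr.
pose Q := (1 + C) *+ 2.
have Q2 : 2 <= Q by rewrite /Q; lra.
have Q0 : 0 < Q by lra.
exists Q => //; split.
  apply: (@sphere_sos_cancel _ _ _ Q) => //.
  have -> : Q%:MP_[n] * (1 - Q^-1%:MP_[n] * q) =
      ((1 + C)%:MP_[n] - q) + (1 + C)%:MP_[n].
    rewrite mulrBr mulr1 mulrA -mpolyCM divff ?gt_eqF // /Q; ring.
  by apply: sphere_sosD => //; apply: sphere_sosC; lra.
move=> x [_ x1]; have := sphere_sos_eval x1 sCq.
rewrite mevalB mevalC => qx; rewrite mulrC ler_pdivrMr // /Q; lra.
Qed.

(** With w = 1 - q / Q, the factor of f is the polynomial form of (1 - w^m) / q. Near the all-ones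
    point h is bounded below and the f term is nonnegative; farther away w^m makes h negligible and
    the f term dominates. *)
Lemma flatten_lower f h (kappa Q : R) : 0 < kappa -> 2 <= Q ->
  (forall x, Spi pi x -> kappa * (q).@[x] <= f.@[x]) ->
  (forall x, Spi pi x -> Q^-1 * (q).@[x] <= 1 / 2) ->
  0 < h.@[one] ->
  exists m0, forall m, (m0 <= m)%N -> exists2 eta : R, 0 < eta &
    forall x, Spi pi x ->
      eta <= (h * (1 - Q^-1%:MP_[n] * q) ^+ m + Q^-1%:MP_[n] *
        (\sum_(k < m) (1 - Q^-1%:MP_[n] * q) ^+ k) * f).@[x].
Proof.
move=> kappa0 Q2 fq qQ; set v := h.@[one] => v0.
have [C hC] := lip_ex c_ge1 c_pi h; have [C0 _ Ch _] := hC.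
(* Chosen so that C r <= (v / 2)^2: where q <= r, the Lipschitz estimate gives h >= v / 2. *)
pose r := v ^+ 2 / ((1 + C + v ^+ 2) *+ 4).
have v20 : 0 < v ^+ 2 by rewrite exprn_gt0.
have den0 : 0 < (1 + C + v ^+ 2) *+ 4 by lra.
have r0 : 0 < r by rewrite divr_gt0.
have rE : r * ((1 + C + v ^+ 2) *+ 4) = v ^+ 2 by rewrite divfK // gt_eqF.
have r1 : r <= 1 by rewrite ler_pdivrMr //; lra.
have Cr : C * r <= (v / 2) ^+ 2 by nra.
have Q0 : 0 < Q by lra.
pose rho := 1 - r / Q.
have rQ : r / Q <= 1 / 2 by rewrite ler_pdivrMr //; lra.
have rQ0 : 0 < r / Q by rewrite divr_gt0.
have rho01 : 0 <= rho < 1 by rewrite /rho; apply/andP; split; lra.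
(* Half of the value kappa r / Q that the f term guarantees where q > r. *)
pose e := kappa * (r / Q) / 2.
have e0 : 0 < e by rewrite divr_gt0 // mulr_gt0.
have [|m0 small] := expr_small rho01 (e := e / (1 + C)).
  by rewrite divr_gt0 //; lra.
(* The successor makes m positive, so the geometric sum contains its first term 1. *)
exists m0.+1 => m m0m; have {}small := small m (ltnW m0m).
have smallC : rho ^+ m * (1 + C) <= e by rewrite -ler_pdivlMr //; lra.
exists (Num.min e (v / 2 * (1 / 2) ^+ m)).
  by rewrite lt_min e0 mulr_gt0 ?exprn_gt0 //; lra.
move=> x xS; have [x0 x1] := xS.
pose qx := (q).@[x]; pose w := 1 - Q^-1 * qx.
have qx0 : 0 <= qx by apply: sos_eval; apply: sos_dist2.
have w12 : 1 / 2 <= w by rewrite /w; have := qQ x xS; rewrite -/qx; lra.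
have w0 : 0 <= w by lra.
have wx : (1 - Q^-1%:MP_[n] * q).@[x] = w.
  by rewrite mevalB meval1 mevalM mevalC.
have fx0 : kappa * qx <= f.@[x] by apply: fq.
rewrite mevalD !mevalM mevalC rmorphXn /= wx rmorph_sum /=.
under eq_bigr do rewrite rmorphXn /= wx.
have sum1 : 1 <= \sum_(k < m) w ^+ k.
  case: m m0m {small smallC} => // m _; rewrite big_ord_recl expr0 lerDl.
  by apply: sumr_ge0 => k _; apply: exprn_ge0.
set S := \sum_(k < m) _ in sum1 *.
have tf : Q^-1 * (kappa * qx) <= Q^-1 * S * f.@[x].
  rewrite -mulrA ler_wpM2l ?invr_ge0 ?(ltW Q0) //.
  have kq0 : 0 <= kappa * qx by rewrite mulr_ge0 // ltW.
  by apply: (le_trans fx0); apply: ler_peMl => //; apply: le_trans fx0.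
have tf0 : 0 <= Q^-1 * (kappa * qx).
  by rewrite !mulr_ge0 // ?invr_ge0 ltW.
rewrite ge_min; have [qr|qr] := lerP qx r; apply/orP; [right|left].
  have hx : v / 2 <= h.@[x].
    have := lip_dist hC box_one x1.
    rewrite -dist2_eval -/qx -/v => hv.
    have : (h.@[x] - v) ^+ 2 <= (v / 2) ^+ 2.
      by apply: le_trans hv _; apply: le_trans Cr; rewrite ler_wpM2l.
    nra.
  rewrite -[leLHS]addr0 lerD //; last exact: le_trans tf.
  rewrite ler_pM ?exprn_ge0 // ?lerXn2r // ?nnegrE; lra.
have hx : - (1 + C) <= h.@[x].
  have := sphere_sos_eval x1 Ch.
  rewrite mevalB mevalC rmorphXn /= => hx; nra.
have wm : w ^+ m <= rho ^+ m.
  rewrite lerXn2r // ?nnegrE //; first by case/andP: rho01.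
  by rewrite /w /rho lerD2l lerN2 mulrC ler_pM2l ?invr_gt0 // ltW.
have wm0 : 0 <= w ^+ m by apply: exprn_ge0.
have hw : - e <= h.@[x] * w ^+ m by nra.
have : e *+ 2 <= Q^-1 * (kappa * qx).
  rewrite (_ : e *+ 2 = Q^-1 * (kappa * r)); last by rewrite /e; field; rewrite gt_eqF.
  by rewrite ler_pM2l ?invr_gt0 // ler_pM2l // ltW.
lra.
Qed.

(* With w = 1 - q / Q, the weights g i are replaced by
   g i * w ^+ m + (1 - w ^+ m) / q * f and s by w ^+ m * s, which keeps the
   decomposition of f; away from its zero the new weights are close to f / q > 0. *)
Lemma Spi_module_local f s (g : 'I_n -> {mpoly R[n]}) (kappa : R) : 0 < kappa ->
  (forall x, Spi pi x -> kappa * (q).@[x] <= f.@[x]) -> sos s ->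
  eq_sphere pi f (s + \sum_i ('X_i - 1) ^+ 2 * g i) ->
  (forall i, 0 < (g i).@[one]) ->
  Spi_module pi f.
Proof.
move=> kappa0 fq ss fs g1.
have [Q Q2 [sw qQ]] := dist2_bound.
have := fun i => flatten_lower kappa0 Q2 fq qQ (g1 i).
move=> /fin_all_exists[m0 lower].
pose m := (\sum_i m0 i)%N.
set w := 1 - Q^-1%:MP_[n] * q in sw lower.
pose t : {mpoly R[n]} := Q^-1%:MP_[n] * \sum_(k < m) w ^+ k.
have tq : t * q = 1 - w ^+ m.
  rewrite -opprB subrX1 /t -mulNr opprB /w; set W := \sum_(k < m) _; ring.
apply: (@Spi_module_eq _ _ _ _
   (w ^+ m * s + \sum_i ('X_i - 1) ^+ 2 * (g i * w ^+ m + t * f))).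
  have -> : \sum_i ('X_i - 1) ^+ 2 * (g i * w ^+ m + t * f) =
     w ^+ m * (\sum_i ('X_i - 1) ^+ 2 * g i) + t * q * f.
    rewrite mulr_sumr /dist2 mulr_sumr mulr_suml -big_split.
    by apply: eq_bigr => i _; rewrite mpolyC1 /=; ring.
  case: fs => phi fs; exists (w ^+ m * phi); rewrite tq.
  set G := \sum_i _ in fs *.
  transitivity (w ^+ m * (s + G + phi * (nn - 1)) + (1 - w ^+ m) * f).
    by rewrite -fs; ring.
  by ring.
apply: Spi_moduleD.
  by apply/Spi_moduleW/sphere_sosM; [apply: sphere_sosX|apply: sphere_sosW].
apply: Spi_module_sum => i _; apply: Spi_moduleM; first exact: sphere_sos_sqr.
have [|eta eta0 geta] := lower i m.
  by rewrite /m (bigD1 i) //= leq_addr.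
exact: (putinar_Spi c_ge1 c_pi eta0 geta).
Qed.

End LocalGlobal.

(** * Curves on the sphere through the all-ones point *)

Section TangentCurve.
Local Open Scope classical_set_scope.
Context {R : realType} {n : nat} (pi : 'I_n -> R).
Context (pi_gt0 : forall i, 0 < pi i) (pi_sum : \sum_i pi i = 1).
Context (v : 'I_n -> R) (v_tangent : \sum_i pi i * v i = 0).
Local Notation one := (fun _ : 'I_n => 1 : R).
Local Notation w := (normpi2 pi v).

(** Stereographic parametrization: for v nonzero, the line through the all-ones point in direction v
    - a w meets the sphere again at parameter [speed a], a rational function of a. *)
Definition speed (a : R) : R := a *+ 2 / (1 + a ^+ 2 * w).

Definition curve (a : R) (i : 'I_n) : R := 1 + speed a * (v i - a * w).

Lemma normpi2_ge0 x : 0 <= normpi2 pi x.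
Proof. by apply: sumr_ge0 => i _; rewrite mulr_ge0 ?sqr_ge0 // ltW. Qed.

Lemma curve_den_gt0 (a : R) : 0 < 1 + a ^+ 2 * w.
Proof.
by rewrite ltr_pwDl // mulr_ge0 ?sqr_ge0 ?normpi2_ge0.
Qed.

Lemma sum_affine_sqr (A B : R) :
  \sum_i pi i * (A + B * v i) ^+ 2 = A ^+ 2 + B ^+ 2 * w.
Proof.
transitivity (A ^+ 2 * \sum_i pi i + A * B *+ 2 * (\sum_i pi i * v i)
   + B ^+ 2 * w); last by rewrite pi_sum v_tangent; ring.
rewrite /normpi2 !mulr_sumr -!big_split.
by apply: eq_bigr => i _ /=; ring.
Qed.

Lemma curve_norm a : normpi2 pi (curve a) = 1.
Proof.
have D0 := curve_den_gt0 a.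
rewrite -[RHS](_ : (1 - speed a * (a * w)) ^+ 2 + speed a ^+ 2 * w = 1).
  rewrite -sum_affine_sqr; apply: eq_bigr => i _; congr (_ * _ ^+ 2).
  by rewrite /curve; ring.
by rewrite /speed; field; rewrite gt_eqF.
Qed.

Lemma curve_Spi : \forall a \near 0^'+, 0 < a /\ Spi pi (curve a).
Proof.
(* When a M <= 1, a^2 w + 2a |v_i| is at most 1, so the numerator of every coordinate of the curve
   is nonnegative. *)
pose M := 1 + w + (\sum_i `|v i|) *+ 2.
have w0 := normpi2_ge0 v.
have s0 : 0 <= \sum_i `|v i| by apply: sumr_ge0.
have M1 : 1 <= M by rewrite /M; lra.
near=> a; have a0 : 0 < a by near: a; exact: nbhs_right_gt.
have aM : a * M <= 1.
  rewrite -ler_pdivlMr ?(lt_le_trans ltr01) // ltW //.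
  near: a; apply: nbhs_right_lt; rewrite div1r invr_gt0.
  exact: lt_le_trans M1.
split=> //; split=> [i|]; last exact: curve_norm.
have D0 := curve_den_gt0 a.
have -> : curve a i = ((1 - a ^+ 2 * w) + a *+ 2 * v i) / (1 + a ^+ 2 * w).
  by rewrite /curve /speed; field; rewrite gt_eqF.
apply: divr_ge0; last exact: ltW.
have vi : `|v i| <= \sum_i `|v i|.
  by rewrite (bigD1 i) //= lerDl sumr_ge0.
have {}vi : - (\sum_i `|v i|) <= v i by move: vi; rewrite ler_norml => /andP[].
have a1 : a <= 1 by nra.
have aw : a ^+ 2 * w <= a * w by rewrite ler_wpM2r // expr2 ler_piMl // ltW.
have av : a * - (\sum_i `|v i|) <= a * v i by rewrite ler_wpM2l // ltW.
rewrite /M in aM; lra.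
Unshelve. all: by end_near. Qed.

Lemma cvg_sum_fin (I : finType) (f : I -> R -> R) (l : I -> R) :
  (forall i, f i a @[a --> 0^'+] --> l i) ->
  \sum_i f i a @[a --> 0^'+] --> \sum_i l i.
Proof.
by move=> fl; apply: cvg_big => //; exact: add_continuous.
Qed.

Lemma cvg_id0 : a @[a --> 0^'+] --> (0 : R).
Proof. by apply: cvg_at_right_filter; apply: cvg_id. Qed.

Lemma speed_cvg : speed a @[a --> 0^'+] --> (0 : R).
Proof.
rewrite [X in _ --> X](_ : 0 = (0 + 0) * (1 + 0 * 0 * w)^-1); last first.
  by rewrite addr0 mul0r.
apply: cvgM; first by under eq_cvg do rewrite mulr2n; apply: cvgD; exact: cvg_id0.
apply: cvgV; first by rewrite !mul0r addr0 oner_eq0.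
apply: cvgD; first exact: cvg_cst.
by apply: cvgM; [apply: cvgM; exact: cvg_id0|exact: cvg_cst].
Qed.

Lemma shift_cvg i : v i - a * w @[a --> 0^'+] --> v i.
Proof.
rewrite -[X in _ --> X]subr0 -[X in _ - X](mul0r w).
by apply: cvgB; [exact: cvg_cst|apply: cvgM; [exact: cvg_id0|exact: cvg_cst]].
Qed.

Lemma curve_cvg (h : {mpoly R[n]}) : h.@[curve a] @[a --> 0^'+] --> h.@[one].
Proof.
move: h; apply: mpoly_alg_ind => [b|i|g h gl hl|g h gl hl].
- by under eq_cvg do rewrite mevalC; rewrite mevalC; exact: cvg_cst.
- have lim : curve a i @[a --> 0^'+] --> 1 + 0 * v i.
    apply: cvgD; first exact: cvg_cst.
    by apply: cvgM; [exact: speed_cvg|exact: shift_cvg].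
  rewrite mul0r addr0 in lim.
  by under eq_cvg do rewrite mevalXU; rewrite mevalXU.
- by under eq_cvg do rewrite mevalD; rewrite mevalD; apply: cvgD.
- by under eq_cvg do rewrite mevalM; rewrite mevalM; apply: cvgM.
Qed.

Context (h : 'I_n -> 'I_n -> {mpoly R[n]}).

Definition quad_part : {mpoly R[n]} :=
  \sum_i \sum_j ('X_i - 1) * ('X_j - 1) * h i j.

Definition curve_quad (a : R) : R :=
  \sum_i \sum_j (v i - a * w) * (v j - a * w) * (h i j).@[curve a].

Lemma quad_part_curve a : (quad_part).@[curve a] = speed a ^+ 2 * curve_quad a.
Proof.
rewrite /quad_part /curve_quad rmorph_sum mulr_sumr; apply: eq_bigr => i _.
rewrite /= rmorph_sum mulr_sumr; apply: eq_bigr => j _.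
by rewrite /= !mevalM !mevalB !mevalXU meval1 /curve; ring.
Qed.

Lemma curve_quad_cvg : curve_quad a @[a --> 0^'+] -->
  \sum_i \sum_j v i * v j * (h i j).@[one].
Proof.
apply: cvg_sum_fin => i; apply: cvg_sum_fin => j.
by apply: cvgM; [apply: cvgM; exact: shift_cvg|exact: curve_cvg].
Qed.

(** Evaluate on the curve, divide by [speed a] > 0 and let a tend to 0 from the right. *)
Lemma tangent_first_order (b : 'I_n -> R) :
  (forall x, Spi pi x ->
     0 <= (\sum_i (b i)%:MP_[n] * ('X_i - 1) + quad_part).@[x]) ->
  0 <= \sum_i b i * v i.
Proof.
move=> f0.
have lim : \sum_i b i * (v i - a * w) + speed a * curve_quad a @[a --> 0^'+] -->
    \sum_i b i * v i.
  rewrite -[X in _ --> X]addr0 -[X in _ + X](mul0r (\sum_i \sum_j v i * v j * (h i j).@[one])).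
  apply: cvgD; last by apply: cvgM; [exact: speed_cvg|exact: curve_quad_cvg].
  by apply: cvg_sum_fin => i; apply: cvgM; [exact: cvg_cst|exact: shift_cvg].
apply: (cvgr_to_ge lim); near=> a.
have [a0 aS] : 0 < a /\ Spi pi (curve a) by near: a; exact: curve_Spi.
have sp0 : 0 < speed a.
  by rewrite divr_gt0 ?curve_den_gt0 // mulrn_wgt0.
rewrite -(pmulr_rge0 _ sp0).
have := f0 _ aS; rewrite mevalD quad_part_curve.
congr (_ <= _); rewrite mulrDr [in RHS]mulrA -expr2; congr (_ + _).
rewrite rmorph_sum mulr_sumr; apply: eq_bigr => i _.
by rewrite /= mevalM mevalC mevalB mevalXU meval1 /curve; ring.
Unshelve. all: by end_near. Qed.

(** On the curve the squared pi-distance to the all-ones point is at least [speed a ^+ 2] times w;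
    divide by that square and pass to the limit. *)
Lemma tangent_second_order (kappa : R) : 0 <= kappa ->
  (forall x, Spi pi x ->
     kappa * (\sum_i pi i * (x i - 1) ^+ 2) <= (quad_part).@[x]) ->
  kappa * w <= \sum_i \sum_j v i * v j * (h i j).@[one].
Proof.
move=> kappa0 f0; apply: (cvgr_to_ge curve_quad_cvg); near=> a.
have [a0 aS] : 0 < a /\ Spi pi (curve a) by near: a; exact: curve_Spi.
have sp0 : 0 < speed a.
  by rewrite divr_gt0 ?curve_den_gt0 // mulrn_wgt0.
rewrite -(ler_pM2l (exprn_gt0 2 sp0)) -quad_part_curve.
apply: le_trans (f0 _ aS).
rewrite (eq_bigr (fun i => pi i * (- (speed a * (a * w)) + speed a * v i) ^+ 2)).
  rewrite sum_affine_sqr mulrCA ler_wpM2l //.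
  by rewrite lerDr sqr_ge0.
by move=> i _; rewrite /curve; congr (_ * _ ^+ 2); ring.
Unshelve. all: by end_near. Qed.

End TangentCurve.

(** * Polynomials with a nondegenerate zero *)

(** Stated over a ring because it serves both real vectors and the polynomials y_i. With 2t the sum
    of the r_i and r the row sums of T, the updated matrix is T evaluated after subtracting the
    p-mean from v. *)
Lemma sum_rank_one_update (S : comPzRingType) (n : nat) (T : 'I_n -> 'I_n -> S)
    (p r v : 'I_n -> S) (t : S) :
  \sum_i \sum_j (T i j - r i * p j - p i * r j + (t + t) * (p i * p j)) * v i * v j =
  (\sum_i \sum_j T i j * v i * v j)
  - (\sum_i p i * v i) *+ 2 * (\sum_i r i * v i - t * \sum_i p i * v i).
Proof.
set s := \sum_i p i * v i; set u := \sum_i r i * v i.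
have inner i : \sum_j (T i j - r i * p j - p i * r j + (t + t) * (p i * p j)) * v i * v j =
    (\sum_j T i j * v i * v j)
    + s * ((t + t) * (p i * v i) - r i * v i) + u * - (p i * v i).
  rewrite /s /u !mulr_suml -!big_split; apply: eq_bigr => j _ /=; ring.
under eq_bigr do rewrite inner.
rewrite !big_split /= -!mulr_sumr sumrN sumrB -mulr_sumr -/s -/u.
by ring.
Qed.

Section LocalForm.
Context {R : realType} {n : nat} (pi : 'I_n -> R) (c : R).
Context (c_ge1 : 1 <= c) (c_pi : forall i, 1 <= c ^+ 2 * pi i).
Context (pi_gt0 : forall i, 0 < pi i) (pi_sum : \sum_i pi i = 1).
Implicit Types (f : {mpoly R[n]}) (h : 'I_n -> 'I_n -> {mpoly R[n]}).
Local Notation nn := (normpi2_poly pi : {mpoly R[n]}).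
Local Notation one := (fun _ : 'I_n => 1 : R).
Local Notation y i := ('X_i - 1 : {mpoly R[n]}).
Local Notation mean := (\sum_i (pi i)%:MP_[n] * y i).
Local Notation ynorm := (\sum_i (pi i)%:MP_[n] * y i ^+ 2).

(** Applied to f and then to its coefficients, this yields a linear part with constant coefficients
    and a [quad_part]. *)
Lemma taylor_one f : exists d : 'I_n -> {mpoly R[n]},
  f = (f.@[one])%:MP_[n] + \sum_i y i * d i.
Proof.
move: f; apply: mpoly_alg_ind => [a|i|f g [d fd] [e ge]|f g [d fd] [e ge]].
- exists (fun=> 0); rewrite mevalC big1 ?addr0 // => i _; exact: mulr0.
- exists (fun j => (j == i)%:R); rewrite mevalXU (bigD1 i) //= eqxx big1.
    by rewrite mulr1 addr0 mpolyC1 addrC subrK.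
  by move=> j /negbTE->; rewrite mulr0.
- exists (fun i => d i + e i); rewrite mevalD {1}fd {1}ge.
  under [in RHS]eq_bigr do rewrite mulrDr.
  by rewrite big_split /=; ring.
- exists (fun i => d i * g + (f.@[one])%:MP_[n] * e i); rewrite mevalM.
  under [in RHS]eq_bigr do rewrite mulrDr mulrA mulrCA.
  rewrite big_split /= -mulr_suml -mulr_sumr {1}fd.
  set D := \sum_i _ * d i; set E := \sum_i _ * e i in ge *.
  transitivity (D * g + (f.@[one])%:MP_[n] * g); first by ring.
  by rewrite {2}ge; ring.
Qed.

(** Because the weights sum to 1, |x|_pi^2 - 1 = 2 [mean] + [ynorm]: the normal component of y is
    quadratic on the sphere. *)
Lemma mean_eq_sphere : eq_sphere pi (mean *+ 2) (- ynorm).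
Proof.
exists 1; rewrite mul1r /normpi2_poly.
rewrite -[X in _ - X]mpolyC1 -pi_sum rmorph_sum -sumrN -sumrB -big_split -sumrMnl.
by apply: eq_bigr => i _; rewrite /= /cst /X; ring.
Qed.

(** Subtracting the pi-mean projects onto the tangent space at the all-ones point, where the
    second-order condition applies. *)
Lemma tangent_psd h (kappa : R) : 0 <= kappa ->
  (forall x, Spi pi x ->
     kappa * (\sum_i pi i * (x i - 1) ^+ 2) <= (quad_part h).@[x]) ->
  forall u, kappa * normpi2 pi (fun i => u i - \sum_k pi k * u k) <=
    quadform (fun i j => (h i j).@[one]) (fun i => u i - \sum_k pi k * u k).
Proof.
move=> kappa0 hS u; set v := fun i => _.
have vt : \sum_i pi i * v i = 0.
  under eq_bigr do rewrite mulrBr.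
  by rewrite sumrB -mulr_suml pi_sum mul1r subrr.
have := tangent_second_order pi_gt0 pi_sum vt kappa0 hS.
congr (_ <= _); apply: eq_bigr => i _; apply: eq_bigr => j _.
by rewrite mulrC mulrA.
Qed.

(** The values of h at the all-ones point, compressed to the tangent space, form a Gram matrix. The
    compression error is a multiple of [mean], hence of [ynorm] on the sphere, and joins the weights
    g_i. *)
Lemma quad_part_local h (kappa : R) : 0 < kappa ->
  (forall i j, h i j = h j i) ->
  (forall x, Spi pi x ->
     kappa * (\sum_i pi i * (x i - 1) ^+ 2) <= (quad_part h).@[x]) ->
  exists s (g : 'I_n -> {mpoly R[n]}),
    [/\ sos s, eq_sphere pi (quad_part h) (s + \sum_i y i ^+ 2 * g i) &
        forall i, 0 < (g i).@[one]].
Proof.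
move=> kappa0 hsym hS; have c1 := c_ge1.
pose k2 := kappa / 2; have k20 : 0 < k2 by rewrite /k2; lra.
pose A i j := (h i j).@[one].
(* Half of kappa is held back for the weights g_i; the other half keeps T nonnegative on tangent
   vectors. *)
pose T i j := A i j - k2 * pi i * (i == j)%:R.
have Tsym i j : T i j = T j i.
  rewrite /T /A hsym eq_sym; case: eqP => [->|] //.
  by rewrite !mulr0.
have diag (S : comNzRingType) (F : 'I_n -> 'I_n -> S) i :
    \sum_j F i j * (i == j)%:R = F i i.
  rewrite (bigD1 i) //= eqxx mulr1 big1 ?addr0 // => j /negbTE ij.
  by rewrite eq_sym ij mulr0.
pose r i := \sum_j T i j.
pose t := (\sum_i r i) / 2.
(* T composed with the projection onto the tangent space, hence positive semidefinite on all
   vectors. *)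
pose a i j := T i j - r i * pi j - pi i * r j + (t + t) * (pi i * pi j).
have asym i j : a i j = a j i by rewrite /a Tsym; ring.
have apsd v : 0 <= quadform a v.
  rewrite /quadform /a sum_rank_one_update.
  have inner b i : \sum_j T i j * (v i - b) * (v j - b) =
      (\sum_j T i j * v i * v j) - b * (\sum_j T i j * v j)
       - b * (r i * v i) + b * (r i * b).
    rewrite /r !mulr_suml !mulr_sumr -!sumrB -big_split.
    by apply: eq_bigr => j _ /=; ring.
  set s := \sum_i pi i * v i; pose z i := v i - s.
  have -> : (\sum_i \sum_j T i j * v i * v j)
      - s *+ 2 * (\sum_i r i * v i - t * s) = quadform T z.
    have tE : t * s *+ 2 = \sum_i r i * s.
      by rewrite -mulr_suml /t; field.
    rewrite /quadform /z; under [in RHS]eq_bigr do rewrite inner.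
    rewrite big_split !sumrB /= -!mulr_sumr -tE.
    have -> : \sum_i \sum_j T i j * v j = \sum_i r i * v i.
      rewrite exchange_big; apply: eq_bigr => j _; rewrite /r mulr_suml.
      by apply: eq_bigr => i _; rewrite Tsym.
    by ring.
  have -> : quadform T z = quadform A z - k2 * normpi2 pi z.
    rewrite /quadform /normpi2 mulr_sumr -sumrB; apply: eq_bigr => i _.
    rewrite -(diag _ (fun i j => k2 * (pi i * (z i * z j)))) -sumrB.
    by apply: eq_bigr => j _; rewrite /T; ring.
  have := tangent_psd (ltW kappa0) hS v; rewrite -/s -/z.
  have : 0 <= normpi2 pi z by apply: normpi2_ge0.
  rewrite /k2 /A; nra.
have [Ls aL] := psd_gram asym apsd.
pose C (b : R) := b%:MP_[n].
pose ry := \sum_i C (r i) * y i - C t * mean.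
have gram : \sum_i \sum_j C (T i j) * y i * y j =
    \sum_(L <- Ls) (\sum_i C (L i) * y i) ^+ 2 + mean *+ 2 * ry.
  apply/eqP; rewrite -subr_eq /ry -sum_rank_one_update; apply/eqP.
  transitivity (\sum_i \sum_j \sum_(L <- Ls) C (L i) * C (L j) * y i * y j).
    apply: eq_bigr => i _; apply: eq_bigr => j _; rewrite -!mulr_suml.
    congr (_ * _ * _); rewrite -[RHS](_ : C (a i j) = _).
      by rewrite /a /C; ring.
    by rewrite aL /C rmorph_sum; apply: eq_bigr => L _; rewrite /= rmorphM.
  under eq_bigr do rewrite exchange_big.
  rewrite exchange_big; apply: eq_bigr => L _.
  rewrite expr2 mulr_suml; apply: eq_bigr => i _.
  by rewrite mulr_sumr; apply: eq_bigr => j _; ring.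
pose e i j := h i j - C (A i j).
(* As c^2 pi_i >= 1, this gives n tau < k2 pi_i, so the weights stay positive at the all-ones
   point. *)
pose tau := k2 / (c ^+ 2 * n.+1%:R).
have cn0 : 0 < c ^+ 2 * n.+1%:R by rewrite mulr_gt0 ?ltr0n // exprn_gt0 //; lra.
have tau0 : 0 < tau by rewrite divr_gt0.
pose sg := (tau *+ 2)^-1.
have tsg : tau * sg *+ 2 = 1 by rewrite /sg; field; rewrite gt_eqF.
(* Completing the square: the cost is tau on y_i^2 and, on y_j^2, a multiple of e_ij^2, which
   vanishes at the all-ones point. *)
have cross i j : y i * y j * e i j = C tau * (y i + C sg * e i j * y j) ^+ 2
    + y i ^+ 2 * - C tau + y j ^+ 2 * - (C (tau * sg ^+ 2) * e i j ^+ 2).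
  transitivity (C (tau * sg *+ 2) * (y i * y j * e i j)).
    by rewrite tsg /C mpolyC1 mul1r.
  by rewrite /C; ring.
exists (\sum_(L <- Ls) (\sum_i C (L i) * y i) ^+ 2
  + \sum_i \sum_j C tau * (y i + C sg * e i j * y j) ^+ 2).
exists (fun i => C (k2 * pi i) - C tau *+ n
   - (\sum_j C (tau * sg ^+ 2) * e j i ^+ 2) - C (pi i) * ry).
split.
- apply: sosD; first by apply: sos_sum => L _; apply: sos_sqr.
  apply: sos_sum => i _; apply: sos_sum => j _; apply: sosM; last exact: sos_sqr.
  exact/sosC/ltW.
- have -> : quad_part h = (\sum_i \sum_j C (T i j) * y i * y j)
     + C k2 * ynorm + \sum_i \sum_j y i * y j * e i j.
    rewrite /quad_part mulr_sumr -!big_split; apply: eq_bigr => i _.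
    rewrite -(diag _ (fun i j => C k2 * (C (pi i) * (y i * y j)))) -!big_split.
    apply: eq_bigr => j _; rewrite /= /e /T /C; ring.
  have -> : \sum_i \sum_j y i * y j * e i j =
      \sum_i \sum_j C tau * (y i + C sg * e i j * y j) ^+ 2
      + \sum_i y i ^+ 2 * - C tau *+ n
      + \sum_i y i ^+ 2 * - (\sum_j C (tau * sg ^+ 2) * e j i ^+ 2).
    under eq_bigr do under eq_bigr do rewrite cross.
    under eq_bigr do rewrite !big_split sumr_const card_ord.
    rewrite !big_split; congr (_ + _); rewrite exchange_big.
    by apply: eq_bigr => i _; rewrite -sumrN mulr_sumr.
  have -> : \sum_i y i ^+ 2 * (C (k2 * pi i) - C tau *+ n
      - (\sum_j C (tau * sg ^+ 2) * e j i ^+ 2) - C (pi i) * ry) =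
      C k2 * ynorm + \sum_i y i ^+ 2 * - C tau *+ n
      + \sum_i y i ^+ 2 * - (\sum_j C (tau * sg ^+ 2) * e j i ^+ 2) - ynorm * ry.
    rewrite mulr_sumr mulr_suml -!big_split -sumrB; apply: eq_bigr => i _.
    by rewrite /= /C mpolyCM; ring.
  have [phi mphi] := mean_eq_sphere.
  by rewrite gram mphi; exists (phi * ry); ring.
- move=> k.
  have y1 i : (y i).@[one] = 0 by rewrite mevalB mevalXU meval1 subrr.
  have ry1 : ry.@[one] = 0.
    rewrite /ry mevalB mevalM !rmorph_sum /= !big1 ?mulr0 ?subr0 // => i _;
      by rewrite mevalM y1 mulr0.
  have e1 j : (e j k).@[one] = 0 by rewrite mevalB mevalC subrr.
  rewrite !mevalB mevalMn !mevalC mevalM ry1 mulr0 subr0 rmorph_sum /= big1 => [|j _].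
    rewrite subr0 subr_gt0 -mulr_natr /tau mulrAC ltr_pdivrMr // -[ltRHS]mulrA ltr_pM2l //.
    rewrite mulrA [pi k * _]mulrC; apply: (lt_le_trans (y := n.+1%:R)).
      by rewrite ltr_nat.
    by rewrite ler_peMl.
  by rewrite mevalM rmorphXn /= e1 expr0n mulr0.
Qed.

(** The first-order condition is tested on both signs of the tangent vector e_k - pi_k 1, so the
    linear part is a multiple of [mean]. *)
Lemma linear_part_mean h (b : 'I_n -> R) :
  (forall x, Spi pi x ->
     0 <= (\sum_i (b i)%:MP_[n] * y i + quad_part h).@[x]) ->
  forall k, b k = pi k * \sum_i b i.
Proof.
move=> f0 k.
have delta (F : 'I_n -> R) : \sum_i F i * (i == k)%:R = F k.
  rewrite (bigD1 k) //= eqxx mulr1 big1 ?addr0 // => i /negbTE->.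
  by rewrite mulr0.
have sgn (e : R) : 0 <= e * (b k - pi k * \sum_i b i).
  pose v i := e * ((i == k)%:R - pi k).
  have lin (F : 'I_n -> R) : \sum_i F i * v i = e * (F k - pi k * \sum_i F i).
    rewrite -{1}(delta F) mulr_sumr -sumrB mulr_sumr.
    by apply: eq_bigr => i _; rewrite /v; ring.
  rewrite -lin; apply: (tangent_first_order pi_gt0 pi_sum _ f0).
  by rewrite lin pi_sum; ring.
have := sgn 1; have := sgn (- 1); lra.
Qed.

(* Doubling f makes the second-order coefficients symmetric without halves. *)
Lemma Spi_module_isolated_zero f (kappa : R) : 0 < kappa -> f.@[one] = 0 ->
  (forall x, Spi pi x -> kappa * (\sum_i pi i * (x i - 1) ^+ 2) <= f.@[x]) ->
  Spi_module pi f.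
Proof.
move=> kappa0 f1 fS; have c1 := c_ge1.
have ynorm0 (x : 'I_n -> R) : 0 <= \sum_i pi i * (x i - 1) ^+ 2.
  by apply: sumr_ge0 => i _; rewrite mulr_ge0 ?sqr_ge0 // ltW.
have [d fd] := taylor_one f.
have /fin_all_exists[h0 dh] i := taylor_one (d i).
pose b i := (d i).@[one].
have fE : f = \sum_i (b i)%:MP_[n] * y i + quad_part h0.
  rewrite {1}fd f1 mpolyC0 add0r /quad_part -big_split; apply: eq_bigr => i _ /=.
  rewrite {1}dh mulrDr [y i * _]mulrC; congr (_ + _).
  by rewrite mulr_sumr; apply: eq_bigr => j _; rewrite mulrA.
have bE := @linear_part_mean h0 b.
have {}bE k : b k = pi k * \sum_i b i.
  apply: bE => x xS; rewrite -fE; apply: le_trans (fS x xS).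
  by rewrite mulr_ge0 // ltW.
set lam := \sum_i b i in bE.
(* On the sphere twice the linear part, 2 lam [mean], equals - lam [ynorm]; it goes to the
   diagonal. *)
pose h i j := h0 i j + h0 j i - (lam * pi i)%:MP_[n] * (i == j)%:R.
have hsym i j : h i j = h j i.
  rewrite /h eq_sym [h0 i j + _]addrC; case: eqP => [->|] //.
  by rewrite !mulr0.
have f2 : eq_sphere pi (f + f) (quad_part h).
  have [phi mphi] := mean_eq_sphere.
  exists (lam%:MP_[n] * phi).
  have -> : quad_part h = quad_part h0 + quad_part h0 - lam%:MP_[n] * ynorm.
    rewrite {2}/quad_part exchange_big /quad_part mulr_sumr -big_split -sumrB.
    apply: eq_bigr => i _ /=.
    have -> : lam%:MP_[n] * ((pi i)%:MP_[n] * y i ^+ 2) =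
        \sum_j (lam * pi i)%:MP_[n] * (y i * y j) * (i == j)%:R.
      rewrite (bigD1 i) //= eqxx mulr1 big1 ?addr0; first by rewrite mpolyCM; ring.
      by move=> j /negbTE ij; rewrite eq_sym ij mulr0.
    rewrite -big_split -sumrB; apply: eq_bigr => j _ /=.
    by rewrite /h; ring.
  have -> : f = lam%:MP_[n] * mean + quad_part h0.
    rewrite {1}fE; congr (_ + _); rewrite mulr_sumr; apply: eq_bigr => i _.
    by rewrite bE mpolyCM; ring.
  transitivity (lam%:MP_[n] * (mean *+ 2) + (quad_part h0 + quad_part h0)).
    by ring.
  by rewrite mphi; ring.
have hS x : Spi pi x ->
    kappa * (\sum_i pi i * (x i - 1) ^+ 2) <= (quad_part h).@[x].
  move=> xS; rewrite -(eq_sphere_eval (proj2 xS) f2) mevalD.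
  have k0 := mulr_ge0 (ltW kappa0) (ynorm0 x); have := fS x xS; lra.
have [s [g [ss hs g1]]] := quad_part_local kappa0 hsym hS.
have c20 : 0 < c ^+ 2 by rewrite exprn_gt0 //; lra.
have M2 : Spi_module pi (f + f).
  (* Since 1 / c^2 <= pi_i, this factor passes from the pi-weighted to the unweighted distance. *)
  apply: (Spi_module_local c_ge1 c_pi (kappa := kappa / c ^+ 2) _ _ ss) g1.
  - by rewrite divr_gt0.
  - move=> x xS; rewrite (eq_sphere_eval (proj2 xS) f2).
    apply: le_trans (hS x xS); rewrite -mulrA ler_pM2l // dist2_eval mulr_sumr.
    apply: ler_sum => i _; rewrite ler_wpM2r ?sqr_ge0 //.
    by rewrite -[_^-1]mul1r ler_pdivrMr // mulrC.
  - exact: eq_sphere_trans f2 hs.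
have -> : f = (2^-1)%:MP_[n] * (f + f).
  rewrite mulrDr -mulrDl -mpolyCD (_ : _ + _ = 1 :> R) ?mpolyC1 ?mul1r //.
  by field.
by apply: Spi_moduleM => //; apply: sphere_sosC; rewrite invr_ge0.
Qed.

End LocalForm.

(** * Entropy and the SOS hierarchy *)

Section SosHierarchy.
Context {R : realType} {n : nat} (pi : 'I_n -> R).
Implicit Types f : {mpoly R[n]}.

Lemma sos_sq_le m k f : (m <= k)%N -> sos_sq m f -> sos_sq k f.
Proof.
move=> mk [qs [/allP dq ->]]; exists qs; split=> //.
by apply/allP => q /dq; rewrite /deg_lt => /leq_trans; apply.
Qed.

Lemma Spi_module_SOS_Spi f : Spi_module pi f ->
  exists d0, forall d, (d0 <= d)%N -> SOS_Spi pi d f.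
Proof.
move=> [s0 [s [[m0 ss0] ss [phi fE]]]].
have /fin_all_exists[m sm] : forall i, exists m, sos_sq m (s i) by [].
exists (m0 + \sum_i m i + (msize phi).+1 + msize f)%N => d dd; split.
  rewrite /deg_lt; apply: leq_trans (leq_addl _ _) (leq_trans dd _).
  by rewrite mul2n -addnn -addnS leq_addr.
exists s0, s, phi; split; first by apply: sos_sq_le ss0; lia.
split=> [i|]; last by split=> //; rewrite /deg_lt; lia.
by apply: sos_sq_le (sm i); move: dd; rewrite (bigD1 i) //=; lia.
Qed.

Lemma SOS_Spi_eval_ge0 d f x : SOS_Spi pi d f -> Spi pi x -> 0 <= f.@[x].
Proof.
move=> [_ [s0 [s [phi [ss0 [ss [_ fE]]]]]]] xS.
apply: (Spi_module_eval xS); exists s0, s; split=> [|i|].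
- by exists d.+1.
- by exists d; apply: ss.
- by exists phi.
Qed.

End SosHierarchy.

(** * Entropy, the Dirichlet form and the relaxed constants *)

Section LogSobolev.
Context {R : realType} {n : nat} (K : 'M[R]_n) (pi : 'I_n -> R).
Implicit Types x : 'I_n -> R.

Lemma dirichlet_poly_eval x : (dirichlet_poly K pi).@[x] = dirichlet K pi x.
Proof.
rewrite /dirichlet_poly /dirichlet mevalM mevalC rmorph_sum; congr (_ * _).
apply: eq_bigr => i _; rewrite /= rmorph_sum; apply: eq_bigr => j _.
by rewrite /= mevalM mevalC rmorphXn /= mevalB !mevalXU.
Qed.

(** Some state has positive mass, a power of K carries mass from it to j, and pi is invariant under
    that power. *)
Lemma stationary_gt0 : markov_kernel K -> irreducible K ->
  stationary_distribution K pi -> forall i, 0 < pi i.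
Proof.
move=> [K0 _] irr [pi0 [pi1 piK]] j.
have pow0 k i l : 0 <= mxpow K k i l.
  elim: k i l => [|k IHk] i l; first by rewrite mxE; case: eqP.
  by rewrite mxE sumr_ge0 // => m _; rewrite mulr_ge0.
have piKk k l : \sum_i pi i * mxpow K k i l = pi l.
  elim: k l => [|k IHk] l.
    rewrite (bigD1 l) //= mxE eqxx mulr1 big1 ?addr0 // => i /negbTE il.
    by rewrite mxE il mulr0.
  rewrite -[RHS]piK.
  under eq_bigr do rewrite mxE mulr_sumr.
  rewrite exchange_big; apply: eq_bigr => m _ /=; rewrite -IHk mulr_suml.
  by apply: eq_bigr => i _; rewrite mulrA.
have [i pii] : exists i, 0 < pi i.
  apply/existsP; apply: contraT; rewrite negb_exists => /forallP pi_le.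
  have : \sum_i pi i = 0.
    by rewrite big1 // => i _; apply/eqP; rewrite eq_le pi0 leNgt pi_le.
  by rewrite pi1 => /eqP; rewrite oner_eq0.
have [k Kk] := irr i j.
rewrite -(piKk k j) (bigD1 i) //= ltr_pwDl ?mulr_gt0 //.
by apply: sumr_ge0 => m _; rewrite mulr_ge0.
Qed.

Context (K0 : forall i j, 0 <= K i j) (pi_gt0 : forall i, 0 < pi i).

Lemma dirichlet_ge0 x : 0 <= dirichlet K pi x.
Proof.
rewrite mulr_ge0 ?invr_ge0 // sumr_ge0 // => i _; rewrite sumr_ge0 // => j _.
by rewrite mulr_ge0 ?sqr_ge0 // mulr_ge0 // ltW.
Qed.

Lemma ent_normalize x : 0 < normpi2 pi x ->
  ent pi (fun i => `|x i| / Num.sqrt (normpi2 pi x)) = ent pi x / normpi2 pi x.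
Proof.
move=> x0; rewrite /ent (proj2 (Spi_normalize x0)) mulr_suml.
apply: eq_bigr => i _.
rewrite expr_div_n sqr_sqrtr ?ltW // real_normK ?num_real // divr1.
by ring.
Qed.

Lemma dirichlet_normalize x : 0 < normpi2 pi x ->
  dirichlet K pi (fun i => `|x i| / Num.sqrt (normpi2 pi x)) <=
  dirichlet K pi x / normpi2 pi x.
Proof.
move=> x0; rewrite /dirichlet -mulrA ler_pM2l ?invr_gt0 // mulr_suml.
apply: ler_sum => i _; rewrite mulr_suml; apply: ler_sum => j _.
rewrite -[leRHS]mulrA ler_wpM2l ?mulr_ge0 // ?(ltW (pi_gt0 i)) //.
rewrite -mulrBl expr_div_n (sqr_sqrtr (ltW x0)) ler_pM2r ?invr_gt0 //.
rewrite -real_normK ?num_real // -[leRHS]real_normK ?num_real //.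
by rewrite ler_pXn2r ?nnegrE // ler_dist_dist.
Qed.

Lemma normpi2_eq0 x : normpi2 pi x = 0 -> ent pi x = 0.
Proof.
move=> /eqP; rewrite psumr_eq0 => [/allP x0|i _]; last first.
  by rewrite mulr_ge0 ?sqr_ge0 // ltW.
rewrite /ent big1 // => i _; have /= := x0 i (mem_index_enum _).
by move=> /eqP->; rewrite mul0r.
Qed.

(** Both sides are homogeneous of degree 2. Taking absolute values preserves the entropy and does
    not increase the Dirichlet form. *)
Lemma log_sobolev_Spi (a : R) :
  (forall x, Spi pi x -> a * ent pi x <= dirichlet K pi x) ->
  forall x, a * ent pi x <= dirichlet K pi x.
Proof.
move=> aS x; have [x0|] := ltrP 0 (normpi2 pi x); last first.
  move=> x0; rewrite normpi2_eq0 ?mulr0 ?dirichlet_ge0 //.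
  by apply/eqP; rewrite eq_le x0 normpi2_ge0.
have := le_trans (aS _ (Spi_normalize x0)) (dirichlet_normalize x0).
by rewrite ent_normalize // mulrA ler_pM2r ?invr_gt0.
Qed.

(** From ln s <= s - 1 at s = 1/t one gets t ln t >= t - 1; multiply by 2t. At t = 0 the convention
    for [ln 0] gives equality. *)
Lemma sqr_ln_lower (t : R) : 0 <= t ->
  (t - 1) ^+ 2 <= t ^+ 2 * ln (t ^+ 2) - t ^+ 2 + 1.
Proof.
rewrite le_eqVlt => /predU1P[<-|t0]; first by rewrite expr0n /= mul0r; lra.
have lnt : t * - ln t <= 1 - t.
  rewrite -lnV ?posrE //.
  have := @le_ln1Dx R (t^-1 - 1); rewrite addrCA subrr addr0.
  have tV : 0 < t^-1 by rewrite invr_gt0.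
  have tV1 : -1 < t^-1 - 1 by lra.
  move=> /(_ tV1); rewrite -(ler_pM2l t0) mulrBr divff ?gt_eqF //.
  by rewrite mulr1.
rewrite lnXn // mulr2n; nra.
Qed.

(** On S^pi the numbers 1 - x_i^2 have pi-mean 0, so adding them lets [sqr_ln_lower] apply
    termwise. *)
Lemma ent_ge_dist x : \sum_i pi i = 1 -> Spi pi x ->
  \sum_i pi i * (x i - 1) ^+ 2 <= ent pi x.
Proof.
move=> pi1 [x0 x1].
have -> : ent pi x = \sum_i pi i * (x i ^+ 2 * ln (x i ^+ 2) - x i ^+ 2 + 1).
  transitivity (ent pi x - normpi2 pi x + \sum_i pi i).
    by rewrite x1 pi1; ring.
  rewrite /ent /normpi2 -sumrB -big_split; apply: eq_bigr => i _ /=.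
  by rewrite -/(normpi2 pi x) x1 divr1; ring.
by apply: ler_sum => i _; rewrite ler_pM2l // sqr_ln_lower.
Qed.

Lemma ent_ones : \sum_i pi i = 1 -> ent pi (fun=> 1) = 0.
Proof.
move=> pi1; rewrite /ent big1 // => i _.
have -> : normpi2 pi (fun=> 1) = 1.
  by rewrite /normpi2 -[RHS]pi1; apply: eq_bigr => j _; rewrite expr1n mulr1.
by rewrite expr1n divr1 ln1 mulr0.
Qed.

(** If the entropy were nowhere positive, alpha + 1 would also be admissible, against maximality. *)
Lemma log_sobolev_constant_ent_gt0 (alpha : R) :
  is_log_sobolev_constant K pi alpha -> exists2 x, Spi pi x & 0 < ent pi x.
Proof.
move=> [als amax].
have [x ex] : exists x, 0 < ent pi x.
  apply: contrapT => nex.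
  have : alpha + 1 <= alpha.
    apply: amax => x; have : ent pi x <= 0.
      by rewrite leNgt; apply/negP => ex; apply: nex; exists x.
    have := als x; lra.
  lra.
have x0 : 0 < normpi2 pi x.
  rewrite lt_neqAle normpi2_ge0 // andbT eq_sym; apply/eqP => /normpi2_eq0 e0.
  by move: ex; rewrite e0 ltxx.
exists (fun i => `|x i| / Num.sqrt (normpi2 pi x)); first exact: Spi_normalize.
by rewrite ent_normalize // divr_gt0.
Qed.

(** Positive entropy at x0 forces every feasible g to be positive, which excludes [-oo], where
    [alpha_P] would take its default value. The inequality is linear in g and survives the
    infimum. *)
Lemma gamma_starP (P : mpol) d x0 :
  Spi pi x0 -> 0 < ent pi x0 ->
  (forall x, Spi pi x -> ent pi x <= peval x P) ->
  gamma_star K pi P d = +oo%E \/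
  exists g : R, [/\ gamma_star K pi P d = g%:E%E, 0 < g &
    forall x, Spi pi x -> ent pi x <= g * dirichlet K pi x].
Proof.
move=> x0S ex0 PS; rewrite /gamma_star; set G := [set g : R | _]%classic.
have Gent g x : G g -> Spi pi x -> ent pi x <= g * dirichlet K pi x.
  move=> Gg xS; apply: le_trans (PS x xS) _.
  have := SOS_Spi_eval_ge0 Gg xS.
  by rewrite mevalB mevalM mevalC dirichlet_poly_eval subr_ge0.
have low (M : \bar R) : (forall g, G g -> (M <= g%:E)%E) ->
    (M <= ereal_inf [set g%:E%E | g in G])%E.
  by move=> GM; apply: le_ereal_inf_tmp => _ [g Gg <-]; apply: GM.
have Ggt0 g : G g -> 0 < g.
  by move=> Gg; have := Gent g x0 Gg x0S; have := dirichlet_ge0 x0; nra.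
have low0 : (0%:E <= ereal_inf [set g%:E%E | g in G])%E.
  by apply: low => g Gg; rewrite lee_fin ltW ?Ggt0.
case gE : (ereal_inf _) low low0 => [g| |] low low0; [right|by left|by []].
have gS x : Spi pi x -> ent pi x <= g * dirichlet K pi x.
  move=> xS; have [E0|E0] := ltrP 0 (dirichlet K pi x).
    rewrite -ler_pdivrMr // -lee_fin; apply: low => g' Gg'.
    by rewrite lee_fin ler_pdivrMr //; apply: Gent.
  have {}E0 : dirichlet K pi x = 0 by apply/eqP; rewrite eq_le E0 dirichlet_ge0.
  (* With zero Dirichlet form, positive entropy would leave no feasible g and make the infimum
     [+oo]. *)
  rewrite E0 mulr0 leNgt; apply/negP => ex.
  have /low : forall g', G g' -> (+oo <= g'%:E)%E.
    by move=> g' /Gent/(_ xS); rewrite E0 mulr0 leNgt ex.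
  by [].
exists g; split=> //.
by have := gS x0 x0S; have := dirichlet_ge0 x0; nra.
Qed.

End LogSobolev.

Theorem mainTheorem2 (R : realType) (n : nat) (K : 'M[R]_n) (pi : 'I_n -> R)
  (alpha eps : R) (P : @mpol R n) :
  markov_kernel K -> irreducible K -> stationary_distribution K pi ->
  is_log_sobolev_constant K pi alpha ->
  0 < eps < 1 ->
  (forall x : 'I_n -> R, Spi pi x ->
     ent pi x <= peval x P /\ peval x P <= (1 + eps) * ent pi x) ->
  (forall d : nat, deg_lt P (2 * d).+1 -> alpha_P K pi P d <= alpha) /\
  (exists d0 : nat, forall d : nat, (d0 <= d)%N -> deg_lt P (2 * d).+1 ->
     (1 - eps) * alpha <= alpha_P K pi P d).
Proof.
move=> Kmk irr Kpi als /andP[eps0 eps1] PS.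
have pi_gt0 := stationary_gt0 Kmk irr Kpi.
have [K0 _] := Kmk; have [_ [pi1 _]] := Kpi.
have alpha0 : 0 <= alpha.
  by apply: (proj2 als) => x; rewrite mul0r; apply: dirichlet_ge0.
have [x0 x0S ex0] := log_sobolev_constant_ent_gt0 pi_gt0 als.
have gammaP d := gamma_starP K0 pi_gt0 d x0S ex0 (fun x xS => proj1 (PS x xS)).
split=> [d _|].
  (* At [+oo] the value is 0 <= alpha; at a finite g, 1 / g is an admissible log-Sobolev
     constant. *)
  rewrite /alpha_P; case: (gammaP d) => [->|[g [-> g0 gS]]] //.
  apply: (proj2 als); apply: (log_sobolev_Spi K0 pi_gt0) => x xS.
  by rewrite mulrC ler_pdivrMr // mulrC; apply: gS.
(* For alpha = 0 the target value of gamma is undefined, but nonnegativity of [alpha_P] suffices. *)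
have [alpha_eq0|alpha_neq0] := eqVneq alpha 0.
  exists 0%N => d _ _; rewrite alpha_eq0 mulr0 /alpha_P.
  by case: (gammaP d) => [->|[g [-> g0 _]]] //; rewrite invr_ge0 ltW.
have alpha_gt0 : 0 < alpha by rewrite lt_neqAle eq_sym alpha_neq0.
have ea0 : 0 < (1 - eps) * alpha by rewrite mulr_gt0 // subr_gt0.
pose gamma := ((1 - eps) * alpha)^-1.
have gamma0 : 0 < gamma by rewrite invr_gt0.
pose f : {mpoly R[n]} := cst gamma * dirichlet_poly K pi - P.
have fE x : f.@[x] = gamma * dirichlet K pi x - peval x P.
  by rewrite mevalB mevalM mevalC dirichlet_poly_eval.
(* This is 1 / (1 - eps) - (1 + eps): what remains of gamma alpha Ent after the upper bound on P is
   subtracted. *)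
pose kappa := eps ^+ 2 / (1 - eps).
have kappa0 : 0 < kappa by rewrite divr_gt0 ?exprn_gt0 // subr_gt0.
have fS x : Spi pi x -> kappa * (\sum_i pi i * (x i - 1) ^+ 2) <= f.@[x].
  move=> xS; apply: le_trans (_ : kappa * ent pi x <= _).
    by rewrite ler_pM2l // ent_ge_dist.
  rewrite fE; have [_ Px] := PS x xS.
  have gd : gamma * (alpha * ent pi x) <= gamma * dirichlet K pi x.
    by rewrite ler_pM2l //; apply: (proj1 als).
  have ke : kappa * ent pi x = gamma * (alpha * ent pi x) - (1 + eps) * ent pi x.
    by rewrite /kappa /gamma; field; rewrite alpha_neq0 gt_eqF ?subr_gt0.
  by rewrite ke; lra.
have f1 : f.@[fun=> 1] = 0.
  have oneS : Spi pi (fun=> 1).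
    split=> [i|]; first exact: ler01.
    by rewrite /normpi2 -[RHS]pi1; apply: eq_bigr => i _; rewrite expr1n mulr1.
  (* Entropy vanishes at the all-ones point, so the two bounds on P pin its value there to 0. *)
  have := PS _ oneS; rewrite ent_ones // mulr0 => -[P0 P1].
  have d0 : dirichlet K pi (fun=> 1) = 0.
    rewrite /dirichlet big1 ?mulr0 // => i _; rewrite big1 // => j _.
    by rewrite subrr expr0n mulr0.
  by rewrite fE d0 mulr0 sub0r; apply/eqP; rewrite oppr_eq0 eq_le P0 P1.
pose c := 1 + \sum_i (pi i)^-1.
have c1 : 1 <= c.
  by rewrite lerDl sumr_ge0 // => i _; rewrite invr_ge0 ltW.
have c_pi i : 1 <= c ^+ 2 * pi i.
  have ci : (pi i)^-1 <= c.
    rewrite /c (bigD1 i) //= addrCA lerDl addr_ge0 // sumr_ge0 // => j _.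
    by rewrite invr_ge0 ltW.
  rewrite -ler_pdivrMr // div1r; apply: le_trans ci _.
  by rewrite expr2 ler_peMl // (le_trans ler01).
have [d0 fd0] := Spi_module_SOS_Spi
  (Spi_module_isolated_zero c1 c_pi pi_gt0 pi1 kappa0 f1 fS).
exists d0 => d d0d _; rewrite /alpha_P.
have : (gamma_star K pi P d <= gamma%:E)%E.
  by apply: ereal_inf_lbound; exists gamma => //; apply: fd0.
case: (gammaP d) => [->|[g [-> g0 _]]] //.
by rewrite lee_fin => g_le; rewrite -[leLHS]invrK lef_pV2 ?posrE.
Qed.
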